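(* Fix integers $d\ge 1$, $n\ge k\ge 2$. For $X=\{x_i\}_{i\in[n]}\in(\mathbb{R}^d)^n$ and $\Gamma\in\Pi(n,k)$ let $\Delta$, $r$, $\operatorname{prox}(X,\Gamma)$, $\pi_{\min}:=\frac1n\min_{S\in\Gamma}|S|$ and $\pi_{\max}:=\frac1n\max_{S\in\Gamma}|S|$ be as in the context. There exists an explicit function $C\colon(\mathbb{R}^d)^n\times\Pi(n,k)\to[0,\infty]$ (a ''shape parameter''), which depends on $(X,\Gamma)$ only through the six quantities $d$, $\Delta/r$, $\operatorname{prox}(X,\Gamma)/r$, $k$, $\pi_{\min}$, $\pi_{\max}$, such that: (a) If $X\in(\mathbb{R}^d)^n$ and $\Gamma\in\Pi(n,k)$ satisfy $\operatorname{prox}(X,\Gamma)>0$ and $r\le \Delta/2$, then $C(X,\Gamma)<\infty$, and for every $\epsilon\in(0,\frac12)$ and every Bernoulli rate $p$ with $\mathbb{E}|W|=pn> C(X,\Gamma)\log(1/\epsilon)$, the sketch-and-solve procedure (described in the context) exactly recovers $\Gamma$ from $X$ with probability at least $1-\epsilon$ (the randomness being that of the Bernoulli process defining $W$). (b) $C(X,\Gamma)$ is directly related to (nondecreasing in) $d$, $k$ and $\pi_{\max}$, and inversely related to (nonincreasing in) $\Delta/r$, $\operatorname{prox}(X,\Gamma)/r$ and $\pi_{\min}$.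
   Context: $[n]=\{1,\dots,n\}$. $\Pi(n,k)$ is the set of partitions of $[n]$ into $k$ nonempty sets. For a tuple $X=\{x_i\}_{i\in[n]}$ in $\mathbb{R}^d$ and nonempty $S\subseteq[n]$, $c_S:=\frac1{|S|}\sum_{i\in S}x_i$. For $\Gamma\in\Pi(n,k)$ and $S,T\in\Gamma$, $S\ne T$, define $\alpha_{ST}:=\min_{i\in S}\langle x_i-\frac{c_S+c_T}{2},\frac{c_S-c_T}{\|c_S-c_T\|}\rangle$ and $\beta_{ST}:=\frac12\big((\frac1{|S|}+\frac1{|T|})\sum_{R\in\Gamma}\|X_R\|_{2\to2}^2\big)^{1/2}$, where $X_R$ is the $d\times n$ matrix whose $i$-th column is $x_i-c_R$ if $i\in R$ and $0$ otherwise. Put $\operatorname{prox}(X,\Gamma):=\min_{S\ne T\in\Gamma}(\alpha_{ST}-\beta_{ST})$, $\Delta:=\min_{S\ne T\in\Gamma}\|c_S-c_T\|$, $r:=\max_{S\in\Gamma}\max_{i\in S}\|x_i-c_S\|$. For a tuple $Y=\{y_j\}_{j\in[m]}$, let $D_Y\in\mathbb{R}^{m\times m}$, $(D_Y)_{ij}=\|y_i-y_j\|^2$; the Peng–Wei semidefinite relaxation is: minimize $\frac1{2m}\operatorname{tr}(D_YZ)$ over $Z\in\mathcal{Z}(m,k):=\{Z\in\mathbb{R}^{m\times m}: Z\mathbf 1=\mathbf 1,\ \operatorname{tr}Z=k,\ Z\ge 0 \text{ entrywise},\ Z\succeq 0\}$. For a partition $\Gamma$, $Z_\Gamma:=\sum_{S\in\Gamma}\frac1{|S|}1_S1_S^\top$.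 Sketch-and-solve procedure with rate $p\in(0,1]$: draw $W\subseteq[n]$ by including each index independently with probability $p$; put $X'=\{x_i\}_{i\in W}$; solve the Peng–Wei relaxation for $X'$ to obtain a partition $\Gamma'$ of $W$ into $k$ sets (whose matrix $Z_{\Gamma'}$ is the SDP minimizer); compute centroids $c_{S'}$, $S'\in\Gamma'$; output the partition of $[n]$ obtained by assigning each $x_i$ to the closest centroid $c_{S'}$. ''Exactly recovers $\Gamma$'' means the output equals $\Gamma$. *)

(* Defs.v *)
From HB Require Import structures.
From mathcomp Require Import all_boot all_order all_algebra.
From mathcomp Require Import all_classical all_reals all_analysis.
Set Implicit Arguments. Unset Strict Implicit. Unset Printing Implicit Defensive.
Import Order.TTheory GRing.Theory Num.Theory.
Local Open Scope ring_scope.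
Local Open Scope classical_set_scope.

Section Defs.
Variable R : realType.

Definition dotv (d : nat) (u v : 'cV[R]_d) : R := \sum_(a < d) u a 0 * v a 0.
Definition enorm (d : nat) (u : 'cV[R]_d) : R := Num.sqrt (dotv u u).

Definition centroid (d n : nat) (x : 'I_n -> 'cV[R]_d) (S : {set 'I_n}) : 'cV[R]_d :=
  (#|S|%:R)^-1 *: \sum_(i in S) x i.

Definition opnorm (d n : nat) (A : 'M[R]_(d, n)) : R :=
  sup [set t | exists v : 'cV[R]_n, enorm v = 1 /\ t = enorm (A *m v)].

Definition clmat (d n : nat) (x : 'I_n -> 'cV[R]_d) (S : {set 'I_n}) : 'M[R]_(d, n) :=
  \matrix_(a < d, j < n) (if j \in S then (x j - centroid x S) a 0 else 0).

(* alpha_{ST}: a minimum over the finite nonempty set S, written as an inf *)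
Definition alpha (d n : nat) (x : 'I_n -> 'cV[R]_d) (S T : {set 'I_n}) : R :=
  let u := centroid x S - centroid x T in
  inf [set t | exists i, i \in S /\
     t = dotv (x i - 2%:R^-1 *: (centroid x S + centroid x T)) ((enorm u)^-1 *: u)].

Definition beta (d n : nat) (x : 'I_n -> 'cV[R]_d) (G : {set {set 'I_n}})
  (S T : {set 'I_n}) : R :=
  2%:R^-1 * Num.sqrt (((#|S|%:R)^-1 + (#|T|%:R)^-1) *
                      \sum_(Q in G) (opnorm (clmat x Q)) ^+ 2).

Definition km_prox (d n : nat) (x : 'I_n -> 'cV[R]_d) (G : {set {set 'I_n}}) : R :=
  inf [set t | exists S T, S \in G /\ T \in G /\ S != T /\
                            t = alpha x S T - beta x G S T].

Definition km_Delta (d n : nat) (x : 'I_n -> 'cV[R]_d) (G : {set {set 'I_n}}) : R :=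
  inf [set t | exists S T, S \in G /\ T \in G /\ S != T /\
                            t = enorm (centroid x S - centroid x T)].

Definition km_rad (d n : nat) (x : 'I_n -> 'cV[R]_d) (G : {set {set 'I_n}}) : R :=
  sup [set t | exists S i, S \in G /\ i \in S /\ t = enorm (x i - centroid x S)].

Definition km_pimin (n : nat) (G : {set {set 'I_n}}) : R :=
  inf [set t | exists S, S \in G /\ t = #|S|%:R / n%:R].
Definition km_pimax (n : nat) (G : {set {set 'I_n}}) : R :=
  sup [set t | exists S, S \in G /\ t = #|S|%:R / n%:R].

Definition km_ratio (a b : R) : \bar R := if b == 0 then +oo%E else (a / b)%:E.

Definition distmat (d m : nat) (y : 'I_m -> 'cV[R]_d) : 'M[R]_m :=
  \matrix_(i, j) (enorm (y i - y j)) ^+ 2.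

Definition psd (m : nat) (Z : 'M[R]_m) : Prop :=
  Z^T = Z /\ forall v : 'cV[R]_m, 0 <= (v^T *m Z *m v) 0 0.

Definition PWfeasible (m k : nat) (Z : 'M[R]_m) : Prop :=
  [/\ Z *m (const_mx 1 : 'cV[R]_m) = const_mx 1, \tr Z = k%:R,
      (forall i j, 0 <= Z i j) & psd Z].

Definition PWobj (d m : nat) (y : 'I_m -> 'cV[R]_d) (Z : 'M[R]_m) : R :=
  ((2 * m)%:R)^-1 * \tr (distmat y *m Z).

Definition PWmin (d m k : nat) (y : 'I_m -> 'cV[R]_d) (Z : 'M[R]_m) : Prop :=
  PWfeasible k Z /\ forall Z', PWfeasible k Z' -> PWobj y Z <= PWobj y Z'.

Definition Zpart (m : nat) (G : {set {set 'I_m}}) : 'M[R]_m :=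
  \matrix_(i, j) \sum_(S in G) (if (i \in S) && (j \in S) then (#|S|%:R)^-1 else 0).

Definition sketch (d n : nat) (x : 'I_n -> 'cV[R]_d) (W : {set 'I_n}) :
  'I_#|W| -> 'cV[R]_d := fun j => x (enum_val j).
Arguments sketch {d n} x W.

Definition closest (d n : nat) (x : 'I_n -> 'cV[R]_d) (W : {set 'I_n})
  (G' : {set {set 'I_#|W|}}) (i : 'I_n) (S' : {set 'I_#|W|}) : Prop :=
  S' \in G' /\ forall T', T' \in G' -> T' != S' ->
    enorm (x i - centroid (sketch x W) S') < enorm (x i - centroid (sketch x W) T').

(* assigning every x_i to its closest centroid c_{S'} yields exactly Gamma *)
Definition assignment_recovers (d n : nat) (x : 'I_n -> 'cV[R]_d) (G : {set {set 'I_n}})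
  (W : {set 'I_n}) (G' : {set {set 'I_#|W|}}) : Prop :=
  (forall i, exists S', closest x G' i S') /\
  forall i j S' T', closest x G' i S' -> closest x G' j T' ->
    (S' = T' <-> finset.pblock G i = finset.pblock G j).

Definition km_exact_recovery (d n k : nat) (x : 'I_n -> 'cV[R]_d) (G : {set {set 'I_n}})
  (W : {set 'I_n}) : Prop :=
  (exists Z, PWmin k (sketch x W) Z) /\
  forall Z, PWmin k (sketch x W) Z ->
    exists G' : {set {set 'I_#|W|}},
      [/\ finset.partition G' [set: 'I_#|W|], #|G'| = k, Z = Zpart G' &
          assignment_recovers x G G'].

Definition km_bern_prob (n : nat) (p : R) (E : {set 'I_n} -> Prop) : R :=
  \sum_(W : {set 'I_n}) (if `[< E W >] then p ^+ #|W| * (1 - p) ^+ (n - #|W|) else 0).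

End Defs.

(* Main.v *)
Require Import Defs.
From HB Require Import structures.
From mathcomp Require Import all_boot all_order all_algebra.
From mathcomp Require Import all_classical all_reals all_analysis.
From mathcomp Require Import ring lra.
Import Order.TTheory GRing.Theory Num.Theory.
Local Open Scope ring_scope.
Set Implicit Arguments.
Unset Strict Implicit.
Unset Printing Implicit Defensive.

(** Write [e_i] for the deviation of [x_i] from the centroid of its cluster and
    [s] for the sum of the squared operator norms of the centered clusters.
    Positive proximity yields a dual certificate for the Peng-Wei program: the
    squared distances split as
      [D_ij = a_i + a_j - 2 s (i == j) + B_ij + Q_ij],
    where [Q = 2 s (1 - Z_Gamma) - 2 (e_i . H_ST e_j)_ij], with [H_ST] the
    reflection across the hyperplane orthogonal to [c_S - c_T], is positive
    semidefinite by Cauchy-Schwarz, and [B] vanishes inside the clusters and equals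
      [4 alpha_i alpha_j - (1/|S| + 1/|T|) s > 0]
    across them ([alpha_i] being the signed distance of [x_i] to the bisecting
    hyperplane); hence [Z_Gamma] is the unique minimizer.

    The certificate only involves cluster sizes, centroids and covariances. A
    Chernoff bound for each of these [k (d+1)^2] empirical moments shows that the
    sketched ones deviate by a relative error [t], except with probability at most
    [2 k (d+1)^2 exp (- p n pi_min t^2 / 8)]. The proximity margin absorbs this
    error as soon as [t <= min(1, prox/r)^2 pi_min / (64 d)], and then every point,
    sketched or not, is also strictly closest to the sketched centroid of its own
    cluster. *)

(** * Finite sums and Euclidean geometry *)

Lemma sum_cauchy_schwarz (R : realType) (I : finType) (P : pred I) (a b : I -> R) :
  (\sum_(i | P i) a i * b i) ^+ 2 <=
  (\sum_(i | P i) a i ^+ 2) * (\sum_(i | P i) b i ^+ 2).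
Proof.
set A := \sum_(i | P i) a i ^+ 2; set B := \sum_(i | P i) b i ^+ 2.
set C := \sum_(i | P i) _.
have B0 : 0 <= B by apply: sumr_ge0 => i _; exact: sqr_ge0.
have [Bz|Bn0] := eqVneq B 0.
  suff -> : C = 0 by rewrite expr0n /= Bz mulr0.
  apply: big1 => i Pi; suff -> : b i = 0 by rewrite mulr0.
  apply/eqP; rewrite -sqrf_eq0.
  move/eqP: Bz; rewrite psumr_eq0 => [/allP/(_ i)|j _]; last exact: sqr_ge0.
  by rewrite Pi; apply; exact: mem_index_enum.
have : 0 <= B * (A * B - C ^+ 2).
  have -> : B * (A * B - C ^+ 2) = \sum_(i | P i) (B * a i - C * b i) ^+ 2.
    rewrite (eq_bigr (fun i => B ^+ 2 * a i ^+ 2 - 2 * B * C * (a i * b i) +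
      C ^+ 2 * b i ^+ 2)) => [|i _]; last by ring.
    rewrite big_split /= sumrB -!mulr_sumr -/A -/B -/C; ring.
  by apply: sumr_ge0 => i _; exact: sqr_ge0.
by rewrite pmulr_rge0 ?lt_def ?Bn0// subr_ge0.
Qed.

Section EuclideanSpace.
Variables (R : realType) (d : nat).
Implicit Types (u v w : 'cV[R]_d) (k : R).

Lemma dotvC u v : dotv u v = dotv v u.
Proof. by apply: eq_bigr => a _; rewrite mulrC. Qed.

Lemma dotvDl u v w : dotv (u + v) w = dotv u w + dotv v w.
Proof. by rewrite -big_split; apply: eq_bigr => a _; rewrite !mxE mulrDl. Qed.

Lemma dotvZl k u v : dotv (k *: u) v = k * dotv u v.
Proof. by rewrite mulr_sumr; apply: eq_bigr => a _; rewrite !mxE mulrA. Qed.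

Lemma dotvNl u v : dotv (- u) v = - dotv u v.
Proof. by rewrite -scaleN1r dotvZl mulN1r. Qed.

Lemma dotvDr u v w : dotv u (v + w) = dotv u v + dotv u w.
Proof. by rewrite dotvC dotvDl !(dotvC u). Qed.

Lemma dotvZr k u v : dotv u (k *: v) = k * dotv u v.
Proof. by rewrite dotvC dotvZl dotvC. Qed.

Lemma dotvNr u v : dotv u (- v) = - dotv u v.
Proof. by rewrite dotvC dotvNl dotvC. Qed.

Lemma dot0v u : dotv 0 u = 0.
Proof. by rewrite -(scale0r 0) dotvZl mul0r. Qed.

Lemma dotv0 u : dotv u 0 = 0.
Proof. by rewrite dotvC dot0v. Qed.

Definition dotvE := (dotvDl, dotvDr, dotvNl, dotvNr, dotvZl, dotvZr).

Lemma dotv_suml (I : finType) (P : pred I) (F : I -> 'cV[R]_d) v :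
  dotv (\sum_(i | P i) F i) v = \sum_(i | P i) dotv (F i) v.
Proof.
apply: (big_morph (fun u => dotv u v)) => [u w|]; [exact: dotvDl|exact: dot0v].
Qed.

Lemma dotv_sumr (I : finType) (P : pred I) (F : I -> 'cV[R]_d) v :
  dotv v (\sum_(i | P i) F i) = \sum_(i | P i) dotv v (F i).
Proof. by rewrite dotvC dotv_suml; apply: eq_bigr => i _; rewrite dotvC. Qed.

Lemma dotv_ge0 u : 0 <= dotv u u.
Proof. by apply: sumr_ge0 => a _; rewrite -expr2 sqr_ge0. Qed.

Lemma dotv_eq0 u : (dotv u u == 0) = (u == 0).
Proof.
apply/idP/eqP => [|->]; last by rewrite dot0v.
rewrite psumr_eq0 => [/allP u0|a _]; last by rewrite -expr2 sqr_ge0.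
apply/matrixP => a b; rewrite (ord1 b) mxE; apply/eqP.
by have := u0 a (mem_index_enum _); rewrite /= mulf_eq0 orbb.
Qed.

Lemma enorm_ge0 u : 0 <= enorm u.
Proof. exact: sqrtr_ge0. Qed.

Lemma sqr_enorm u : enorm u ^+ 2 = dotv u u.
Proof. by rewrite sqr_sqrtr// dotv_ge0. Qed.

Lemma enorm_eq0 u : (enorm u == 0) = (u == 0).
Proof. by rewrite -sqrf_eq0 sqr_enorm dotv_eq0. Qed.

Lemma enormN u : enorm (- u) = enorm u.
Proof. by rewrite /enorm dotvNl dotvNr opprK. Qed.

Lemma ler_norm_dotv u v : `|dotv u v| <= enorm u * enorm v.
Proof.
have e0 : 0 <= enorm u * enorm v by rewrite mulr_ge0 ?enorm_ge0.
rewrite -(ger0_norm e0) -ler_sqr ?nnegrE// !real_normK ?num_real//.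
by rewrite exprMn !sqr_enorm (le_trans (sum_cauchy_schwarz _ _ _)).
Qed.

Lemma ler_dotv u v : dotv u v <= enorm u * enorm v.
Proof. exact: le_trans (ler_norm _) (ler_norm_dotv _ _). Qed.

Lemma ler_dotvN u v : - (enorm u * enorm v) <= dotv u v.
Proof. by rewrite lerNl -dotvNl -(enormN u) ler_dotv. Qed.

Lemma ler_enormD u v : enorm (u + v) <= enorm u + enorm v.
Proof.
rewrite -ler_sqr ?nnegrE ?addr_ge0 ?enorm_ge0// sqrrD !sqr_enorm !dotvE.
by have := ler_dotv u v; rewrite (dotvC v u); lra.
Qed.

Lemma ler_coord_enorm u a : `|u a 0| <= enorm u.
Proof.
rewrite -ler_sqr ?nnegrE ?enorm_ge0// real_normK ?num_real// sqr_enorm.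
rewrite /dotv (bigD1 a)//= -expr2 lerDl sumr_ge0// => b _.
by rewrite -expr2 sqr_ge0.
Qed.

(** The crude factor [d] instead of its square root costs nothing later: the covariance estimate
    requires [t * d] to be small anyway. *)
Lemma ler_enorm_coord u k : 0 <= k -> (forall a, `|u a 0| <= k) ->
  enorm u <= d%:R * k.
Proof.
move=> k0 uk; rewrite -ler_sqr ?nnegrE ?enorm_ge0 ?mulr_ge0// sqr_enorm.
apply: (@le_trans _ _ (\sum_(a < d) k ^+ 2)).
  apply: ler_sum => a _; rewrite -expr2 -(real_normK (num_real (u a 0))).
  by rewrite ler_sqr ?nnegrE.
rewrite sumr_const card_ord -[_ *+ d]mulr_natl exprMn ler_wpM2r ?sqr_ge0//.
by rewrite -natrX ler_nat; case: (d) => // n; rewrite leq_pmulr.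
Qed.

End EuclideanSpace.

(** * Positive semidefinite matrices *)

Section PositiveSemidefinite.
Variables (R : realType) (m : nat).
Implicit Types (Z : 'M[R]_m) (u v : 'cV[R]_m).

Lemma psd_coef Z i j : ((delta_mx i 0 : 'cV_m)^T *m Z *m (delta_mx j 0 : 'cV_m)) 0 0 = Z i j.
Proof. by rewrite trmx_delta -rowE -colE !mxE. Qed.

(** The form evaluated at [u + x *: v] is a nonnegative quadratic polynomial in [x]; its
    discriminant gives the bound. *)
Lemma psd_cauchy_schwarz Z u v : psd Z ->
  ((u^T *m Z *m v) 0 0) ^+ 2 <= (u^T *m Z *m u) 0 0 * (v^T *m Z *m v) 0 0.
Proof.
move=> [Zs Z0]; set b := (u^T *m Z *m v) 0 0.
set a := (u^T *m Z *m u) 0 0; set c := (v^T *m Z *m v) 0 0.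
have q x : 0 <= a + 2 * x * b + x ^+ 2 * c.
  have := Z0 (u + x *: v).
  have bC : (v^T *m Z *m u) 0 0 = b.
    have <- : (u^T *m Z *m v)^T = v^T *m Z *m u by rewrite !trmx_mul trmxK Zs mulmxA.
    by rewrite mxE.
  have -> : (u + x *: v)^T = u^T + x *: v^T by apply/matrixP => ? ?; rewrite !mxE.
  rewrite !mulmxDl !mulmxDr -!scalemxAl -!scalemxAr.
  have addE (A B : 'M[R]_1) : (A + B) 0 0 = A 0 0 + B 0 0 by rewrite mxE.
  have scaleE (A : 'M[R]_1) : (x *: A) 0 0 = x * A 0 0 by rewrite mxE.
  rewrite !(addE, scaleE) -/a -/b -/c bC; congr (0 <= _); ring.
have [c0|cn0] := eqVneq c 0.
  suff -> : b = 0 by rewrite c0 mulr0 expr0n.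
  apply/eqP; apply: contraT => bn0.
  (* With [c = 0] the polynomial is affine of slope [2 * b]; at this point it would take the value
     -1. *)
  have := q (- (a + 1) / (2 * b)); rewrite c0 mulr0 addr0.
  have -> : 2 * (- (a + 1) / (2 * b)) * b = - (a + 1) by field.
  lra.
have c_gt0 : 0 < c by rewrite lt_def cn0 Z0.
have := q (- b / c).
have -> : a + 2 * (- b / c) * b + (- b / c) ^+ 2 * c = (a * c - b ^+ 2) / c by field.
by rewrite pmulr_lge0 ?invr_gt0// subr_ge0.
Qed.

Lemma psd_diag_ge0 Z i : psd Z -> 0 <= Z i i.
Proof. by move=> [_ /(_ (delta_mx i 0))]; rewrite psd_coef. Qed.

Lemma psd_minor Z i j : psd Z -> Z i j ^+ 2 <= Z i i * Z j j.
Proof. by move=> /(psd_cauchy_schwarz (delta_mx i 0) (delta_mx j 0)); rewrite !psd_coef. Qed.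

Lemma psd_diag0_eq0 Z : psd Z -> (forall i, Z i i = 0) -> Z = 0.
Proof.
move=> Zp Z0; apply/matrixP => i j; rewrite mxE; apply/eqP.
by rewrite -sqrf_eq0 eq_le sqr_ge0 andbT (le_trans (psd_minor i j Zp))// Z0 mul0r.
Qed.

(* Each step subtracts the rank-one matrix of a nonzero column, which clears
   that diagonal entry and creates no new nonzero one. *)
Lemma psd_rank1_sum Z : psd Z -> exists vs : seq 'cV[R]_m, Z = \sum_(v <- vs) v *m v^T.
Proof.
have [n] := ubnP #|[pred i | Z i i != 0]|; elim: n Z => // n IH Z cardZ Zp.
have [k /= Zkk|Z0] := pickP [pred i | Z i i != 0]; last first.
  exists [::]; rewrite big_nil; apply: psd_diag0_eq0 => // i.
  by apply/eqP; move: (Z0 i) => /= /negbFE.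
have Zkk_gt0 : 0 < Z k k by rewrite lt_def Zkk psd_diag_ge0.
pose w : 'cV_m := (Num.sqrt (Z k k))^-1 *: col k Z.
have wE i j : (w *m w^T) i j = Z i k * Z j k / Z k k.
  rewrite mxE big_ord1 !mxE -[X in _ / X](sqr_sqrtr (ltW Zkk_gt0)); field.
  by rewrite sqrtr_eq0 -ltNge.
have [Zs Z0] := Zp.
have Z'p : psd (Z - w *m w^T).
  split; first by rewrite linearB /= Zs trmx_mul trmxK.
  move=> v; rewrite mulmxBr mulmxBl mxE [X in _ + X]mxE subr_ge0.
  (* Cauchy-Schwarz against the [k]-th basis vector is exactly the nonnegativity of this Schur
     complement. *)
  have := psd_cauchy_schwarz v (delta_mx k 0) Zp.
  rewrite psd_coef -mulmxA -colE => cs.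
  have -> : (v^T *m (w *m w^T) *m v) 0 0 = ((v^T *m col k Z) 0 0) ^+ 2 / Z k k.
    have -> : v^T *m (w *m w^T) *m v = (v^T *m w) *m (v^T *m w)^T.
      by rewrite trmx_mul trmxK !mulmxA.
    rewrite mxE big_ord1 [X in _ * X]mxE -expr2 -scalemxAr [in LHS]mxE exprMn.
    by rewrite exprVn sqr_sqrtr ?ltW// mulrC.
  by rewrite ler_pdivrMr// mulmxA.
have [|vs Zvs] := IH _ _ Z'p.
  rewrite -ltnS (leq_trans _ cardZ)// ltnS; apply/proper_card/properP; split.
    apply/fintype.subsetP => i; rewrite !inE; apply: contra => /eqP Zii.
    have := psd_minor i k Zp; rewrite Zii mul0r => Zik.
    have /eqP Zik0 : Z i k == 0 by rewrite -sqrf_eq0 eq_le sqr_ge0 andbT.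
    by rewrite mxE [X in _ + X]mxE wE Zii Zik0 !mul0r subrr.
  exists k; first by rewrite inE.
  by rewrite inE negbK mxE [X in _ + X]mxE wE mulfK// subrr.
by exists (w :: vs); rewrite big_cons -Zvs addrC subrK.
Qed.

(** One half of the self-duality of the semidefinite cone: on each rank-one term of [Z] the pairing
    is a value of the quadratic form of [Q]. *)
Lemma psd_frobenius_ge0 (Q : 'I_m -> 'I_m -> R) Z : psd Z ->
  (forall v : 'I_m -> R, 0 <= \sum_i \sum_j Q i j * (v i * v j)) ->
  0 <= \sum_i \sum_j Q i j * Z i j.
Proof.
move=> /psd_rank1_sum[vs ->] Q0.
have -> : \sum_i \sum_j Q i j * (\sum_(v <- vs) v *m v^T) i j =
  \sum_(v <- vs) \sum_i \sum_j Q i j * (v i 0 * v j 0).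
  rewrite [RHS]exchange_big; apply: eq_bigr => i _; rewrite [RHS]exchange_big.
  apply: eq_bigr => j _; rewrite summxE mulr_sumr; apply: eq_bigr => v _.
  by rewrite mxE big_ord1 [X in _ * (_ * X)]mxE.
by apply: sumr_ge0 => v _; exact: (Q0 (fun i => v i 0)).
Qed.

End PositiveSemidefinite.

(** * Partitions of a finite type and centroids *)

Lemma partitionT_pblock_in (T : finType) (G : {set {set T}}) (i : T) :
  finset.partition G [set: T] -> finset.pblock G i \in G.
Proof. by case/and3P => /eqP cG _ _; rewrite pblock_mem// cG inE. Qed.

Lemma partitionT_mem_pblock (T : finType) (G : {set {set T}}) (i : T) :
  finset.partition G [set: T] -> i \in finset.pblock G i.
Proof. by case/and3P => /eqP cG _ _; rewrite mem_pblock cG inE. Qed.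

Lemma partitionT_memE (T : finType) (G : {set {set T}}) (S : {set T}) (i : T) :
  finset.partition G [set: T] -> S \in G -> (i \in S) = (finset.pblock G i == S).
Proof.
move=> hG SG; have [_ tG _] := and3P hG.
apply/idP/eqP => [iS|<-]; last exact: partitionT_mem_pblock.
exact: def_pblock.
Qed.

Lemma partitionT_card_gt0 (T : finType) (G : {set {set T}}) (S : {set T}) :
  finset.partition G [set: T] -> S \in G -> (0 < #|S|)%N.
Proof.
case/and3P => _ _ nG SG; rewrite lt0n cards_eq0.
by apply: contraNneq nG => <-.
Qed.

Lemma partitionT_sum (V : nmodType) (T : finType) (G : {set {set T}}) (F : T -> V) :
  finset.partition G [set: T] -> \sum_i F i = \sum_(S in G) \sum_(i in S) F i.
Proof.
move=> hG; rewrite -(set_partition_big _ hG).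
by apply: eq_bigl => i; rewrite inE.
Qed.

Lemma sum_sub_centroid (R : realType) (d n : nat) (x : 'I_n -> 'cV[R]_d) (S : {set 'I_n}) :
  \sum_(i in S) (x i - centroid x S) = 0.
Proof.
rewrite sumrB sumr_const /centroid -scaler_nat scalerA.
have [S0|S0] := eqVneq #|S| 0%N; last by rewrite divff ?pnatr_eq0// scale1r subrr.
by move/cards0_eq: S0 => ->; rewrite big_set0 scaler0 subrr.
Qed.

(** * The partition matrix as an orthogonal projection *)

Section ZpartTheory.
Variables (R : realType) (m : nat) (G : {set {set 'I_m}}).
Hypothesis hG : finset.partition G [set: 'I_m].
Local Notation cl := (finset.pblock G).
Local Notation P := (@Zpart R m G).

Lemma ZpartE i j : P i j = if cl i == cl j then #|cl i|%:R^-1 else 0.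
Proof.
rewrite mxE (bigD1 (cl i)) ?partitionT_pblock_in//= big1 => [|S /andP[SG Si]].
  by rewrite addr0 partitionT_mem_pblock//= (partitionT_memE _ hG)
    ?partitionT_pblock_in// eq_sym.
by rewrite (partitionT_memE _ hG SG) eq_sym (negbTE Si).
Qed.

Lemma ZpartC i j : P i j = P j i.
Proof. by rewrite !ZpartE eq_sym; case: eqP => // ->. Qed.

(** [P] averages over clusters; the later computations with [P] go through this formula. *)
Lemma sum_Zpart i (F : 'I_m -> R) :
  \sum_j P i j * F j = #|cl i|%:R^-1 * \sum_(j in cl i) F j.
Proof.
rewrite mulr_sumr [RHS]big_mkcond; apply: eq_bigr => j _; rewrite ZpartE.
rewrite (partitionT_memE _ hG) ?partitionT_pblock_in// eq_sym.
by case: ifP; rewrite ?mul0r.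
Qed.

Lemma card_pblock_neq0 i : #|cl i|%:R != 0 :> R.
Proof.
by rewrite pnatr_eq0 -lt0n (partitionT_card_gt0 hG)// partitionT_pblock_in.
Qed.

Lemma Zpart_row_sum i : \sum_j P i j = 1.
Proof.
transitivity (\sum_j P i j * 1); first by apply: eq_bigr => j _; rewrite mulr1.
by rewrite sum_Zpart sumr_const -[X in _ * X]mulr_natr mul1r mulVf ?card_pblock_neq0.
Qed.

Lemma Zpart_mul1 : P *m (const_mx 1 : 'cV_m) = const_mx 1.
Proof.
apply/matrixP => i j; rewrite !mxE -[RHS](Zpart_row_sum i).
by apply: eq_bigr => l _; rewrite [X in _ * X]mxE mulr1.
Qed.

Lemma Zpart_trace : \tr P = #|G|%:R.
Proof.
rewrite /mxtrace (partitionT_sum _ hG) -sumr_const; apply: eq_bigr => S SG.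
rewrite (eq_bigr (fun=> #|S|%:R^-1)) => [|i iS].
  by rewrite sumr_const -[LHS]mulr_natr mulVf// pnatr_eq0 -lt0n (partitionT_card_gt0 hG).
by rewrite ZpartE eqxx; move: iS; rewrite (partitionT_memE _ hG SG) => /eqP ->.
Qed.

(** Averaging row [i] of [Z] over a cluster spreads the whole row sum 1 evenly if that cluster
    contains [i], and gives 0 otherwise. *)
Lemma mul_Zpart (Z : 'M[R]_m) : Z *m (const_mx 1 : 'cV_m) = const_mx 1 ->
  (forall i j, cl i != cl j -> Z i j = 0) -> Z *m P = P.
Proof.
move=> Z1 Z0; apply/matrixP => i j; rewrite [LHS]mxE.
under eq_bigr do rewrite ZpartC mulrC; rewrite sum_Zpart ZpartE.
have memE l : (l \in cl j) = (cl l == cl j).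
  by rewrite (partitionT_memE _ hG) ?partitionT_pblock_in.
case: eqP => [ij|/eqP ij]; last first.
  rewrite big1 ?mulr0// => l; rewrite memE.
  by move/eqP => lj; rewrite Z0// lj.
rewrite ij; suff -> : \sum_(l in cl j) Z i l = 1 by rewrite mulr1.
move/matrixP/(_ i 0) : Z1; rewrite !mxE => <-.
rewrite big_mkcond; apply: eq_bigr => l _; rewrite memE [X in _ * X]mxE mulr1.
by case: eqP => // /eqP lj; rewrite Z0// ij eq_sym.
Qed.

Lemma Zpart_idem : P *m P = P.
Proof.
apply: mul_Zpart => [|i j ij]; first exact: Zpart_mul1.
by rewrite ZpartE (negbTE ij).
Qed.

Lemma Zpart_tr : P^T = P.
Proof. by apply/matrixP => i j; rewrite mxE ZpartC. Qed.

Lemma Zpart_psd : psd P.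
Proof.
split=> [|v]; first exact: Zpart_tr.
have -> : v^T *m P *m v = (P *m v)^T *m (P *m v).
  by rewrite trmx_mul Zpart_tr -!mulmxA (mulmxA P P) Zpart_idem.
by rewrite mxE; apply: sumr_ge0 => i _; rewrite [X in X * _]mxE -expr2 sqr_ge0.
Qed.

Lemma Zpart_feasible : PWfeasible #|G| P.
Proof.
split; [exact: Zpart_mul1|exact: Zpart_trace| |exact: Zpart_psd].
by move=> i j; rewrite ZpartE; case: ifP.
Qed.

(* Such a [Z] fixes the range of the projection [P], so [Z - P] is the
   compression of [Z] to the complement: it is positive semidefinite of trace 0. *)
Lemma block_diagonal_feasible (Z : 'M[R]_m) : PWfeasible #|G| Z ->
  (forall i j, cl i != cl j -> Z i j = 0) -> Z = P.
Proof.
move=> [Z1 Ztr _ [Zs Zp]] Z0.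
have ZP : Z *m P = P by exact: mul_Zpart.
have PZ : P *m Z = P by rewrite -[in LHS]Zpart_tr -[in LHS]Zs -trmx_mul ZP Zpart_tr.
have D : psd (Z - P).
  split=> [|v]; first by rewrite linearB /= Zs Zpart_tr.
  have -> : v^T *m (Z - P) *m v = (v - P *m v)^T *m Z *m (v - P *m v).
    have -> : (v - P *m v)^T = v^T - v^T *m P by rewrite raddfB /= trmx_mul Zpart_tr.
    have -> : (v^T - v^T *m P) *m Z = v^T *m (Z - P) by rewrite mulmxBl -mulmxA PZ mulmxBr.
    have ZPP : (Z - P) *m P = 0 by rewrite mulmxBl ZP Zpart_idem subrr.
    by rewrite [RHS]mulmxBr (mulmxA _ P v) -(mulmxA v^T _ P) ZPP mulmx0 mul0mx subr0.
  exact: Zp.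
apply/eqP; rewrite -subr_eq0; apply/eqP/psd_diag0_eq0 => // i.
have : \sum_i (Z - P) i i == 0.
  by move: (mxtraceD Z (- P)); rewrite raddfN /= Ztr Zpart_trace subrr => /eqP.
rewrite psumr_eq0 => [/allP/(_ i (mem_index_enum _))/eqP//|j _].
exact: psd_diag_ge0.
Qed.

End ZpartTheory.

(** * Optimality and uniqueness by a dual certificate *)

Section DualCertificate.
Variables (R : realType) (d m : nat) (y : 'I_m -> 'cV[R]_d) (G : {set {set 'I_m}}).
(** [N S] bounds the squared operator norm of a centered cluster. It is left abstract because for a
    sketch such a bound comes only indirectly, from the full data. *)
Variable N : {set 'I_m} -> R.
Hypothesis hG : finset.partition G [set: 'I_m].
Local Notation cl := (finset.pblock G).
Local Notation P := (@Zpart R m G).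
Local Notation c i := (centroid y (cl i)).
Local Notation e i := (y i - c i).
Local Notation s := (\sum_(S in G) N S).

Hypothesis N_ge0 : forall S, S \in G -> 0 <= N S.
Hypothesis N_bound : forall S (w : 'I_m -> R), S \in G ->
  dotv (\sum_(i in S) w i *: (y i - centroid y S))
       (\sum_(i in S) w i *: (y i - centroid y S)) <= N S * \sum_(i in S) w i ^+ 2.

(** The left side pairs [u] with the reflection of [v] across the hyperplane orthogonal to [g], and
    reflections are isometries. For [g = 0] the quotient is 0 and the reflection becomes the
    identity. *)
Lemma dotv_reflection_le (u v g : 'cV[R]_d) :
  dotv u v - 2 * (dotv g u * dotv g v / dotv g g) <= enorm u * enorm v.
Proof.
have [->|g0] := eqVneq g 0; first by rewrite !dot0v !mul0r mulr0 subr0 ler_dotv.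
pose v' := v - (2 * dotv g v / dotv g g) *: g.
have gg : dotv g g != 0 by rewrite dotv_eq0.
have -> : enorm v = enorm v'.
  rewrite /enorm; congr Num.sqrt; rewrite /v' !dotvE (dotvC v g); field.
  exact: gg.
apply: le_trans (ler_dotv u v'); rewrite /v' !dotvE (dotvC u g) lerD2l lerN2.
by rewrite le_eqVlt; apply/orP; left; apply/eqP; ring.
Qed.

Lemma within_cluster_variance (S : {set 'I_m}) (v : 'I_m -> R) : S \in G ->
  \sum_(i in S) (v i - #|S|%:R^-1 * \sum_(j in S) v j) ^+ 2 =
  \sum_(i in S) (v i ^+ 2 - v i * (#|S|%:R^-1 * \sum_(j in S) v j)).
Proof.
move=> SG; set t := _ * \sum_(j in S) v j.
have St : \sum_(i in S) (v i - t) = 0.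
  rewrite sumrB sumr_const -[t *+ _]mulr_natl /t mulrA divff ?mul1r ?subrr//.
  by rewrite pnatr_eq0 -lt0n (partitionT_card_gt0 hG).
transitivity (\sum_(i in S) (v i ^+ 2 - v i * t) - t * \sum_(i in S) (v i - t)); last first.
  by rewrite St mulr0 subr0.
rewrite mulr_sumr -sumrB.
by apply: eq_bigr => i _; ring.
Qed.

(** The reflection makes the slack across clusters contain a product of a factor in [i] and a factor
    in [j]. Within a cluster the normal vector is 0 and the plain inner product remains. *)
Definition cert_gram i j : R :=
  dotv (e i) (e j) -
  2 * (dotv (c i - c j) (e i) * dotv (c i - c j) (e j) / dotv (c i - c j) (c i - c j)).

(** Grouping by clusters leaves reflected inner products of the weighted sums [f S], so the left
    side is at most the square of the sum of their norms. Each squared norm is at most [N S] times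
    the within-cluster variation [om S] of [v], and Cauchy-Schwarz over the clusters produces
    [s]. *)
Lemma cert_gram_le (v : 'I_m -> R) :
  \sum_i \sum_j cert_gram i j * (v i * v j) <=
  s * \sum_i \sum_j ((i == j)%:R - P i j) * (v i * v j).
Proof.
pose mean (S : {set 'I_m}) := #|S|%:R^-1 * \sum_(j in S) v j.
pose om (S : {set 'I_m}) := \sum_(i in S) (v i - mean S) ^+ 2.
have om0 S : 0 <= om S by apply: sumr_ge0 => i _; exact: sqr_ge0.
have -> : \sum_i \sum_j ((i == j)%:R - P i j) * (v i * v j) = \sum_(S in G) om S.
  rewrite (partitionT_sum _ hG); apply: eq_bigr => S SG.
  rewrite /om within_cluster_variance//; apply: eq_bigr => i iS.
  under eq_bigr do rewrite mulrBl; rewrite sumrB; congr (_ - _).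
    rewrite (bigD1 i)//= eqxx mul1r big1 ?addr0 ?expr2// => j ji.
    by rewrite eq_sym (negbTE ji) mul0r.
  rewrite (eq_bigr (fun j => v i * (P i j * v j))) => [|j _]; last by ring.
  rewrite -mulr_sumr sum_Zpart//.
  by move: iS; rewrite (partitionT_memE _ hG SG) => /eqP ->.
pose f (S : {set 'I_m}) := \sum_(i in S) v i *: (y i - centroid y S).
have clE S i : S \in G -> i \in S -> cl i = S.
  by move=> SG; rewrite (partitionT_memE _ hG SG) => /eqP.
have -> : \sum_i \sum_j cert_gram i j * (v i * v j) =
  \sum_(S in G) \sum_(T in G) (dotv (f S) (f T) -
    2 * (dotv (centroid y S - centroid y T) (f S) * dotv (centroid y S - centroid y T) (f T)
      / dotv (centroid y S - centroid y T) (centroid y S - centroid y T))).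
  rewrite (partitionT_sum _ hG); apply: eq_bigr => S SG.
  under eq_bigr do rewrite (partitionT_sum _ hG).
  rewrite exchange_big; apply: eq_bigr => T TG.
  set g := _ - centroid y T.
  rewrite /f !dotv_suml !dotv_sumr !mulr_suml mulr_sumr -sumrB.
  apply: eq_bigr => i iS; rewrite dotv_sumr mulr_sumr mulr_suml mulr_sumr -sumrB.
  apply: eq_bigr => j jT; rewrite /cert_gram (clE S)// (clE T)// -/g !dotvZl !dotvZr.
  by ring.
have fle S : S \in G -> enorm (f S) <= Num.sqrt (N S) * Num.sqrt (om S).
  move=> SG; rewrite -sqrtrM ?N_ge0//; apply: ler_wsqrtr.
  apply: le_trans (N_bound (fun i => v i - mean S) SG).
  suff -> : f S = \sum_(i in S) (v i - mean S) *: (y i - centroid y S) by [].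
  (* Centering the weights does not change [f S], because deviations from the centroid sum to 0. *)
  under [RHS]eq_bigr do rewrite scalerBl.
  by rewrite sumrB -scaler_sumr sum_sub_centroid scaler0 subr0.
apply: (@le_trans _ _ ((\sum_(S in G) Num.sqrt (N S) * Num.sqrt (om S)) ^+ 2)).
  rewrite expr2 mulr_suml; apply: ler_sum => S SG; rewrite mulr_sumr.
  apply: ler_sum => T TG; apply: le_trans (dotv_reflection_le _ _ _) _.
  by apply: ler_pM; rewrite ?enorm_ge0 ?fle.
apply: le_trans (sum_cauchy_schwarz _ _ _) _.
rewrite (eq_bigr N) => [|S SG]; last by rewrite sqr_sqrtr ?N_ge0.
suff -> : \sum_(S in G) Num.sqrt (om S) ^+ 2 = \sum_(S in G) om S by [].
by apply: eq_bigr => S _; rewrite sqr_sqrtr.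
Qed.

(** Positivity of the slack across clusters, cleared of its denominator. Being strict, it also
    forces distinct centroids. *)
Hypothesis separation : forall i j, cl i != cl j ->
  s * (#|cl i|%:R^-1 + #|cl j|%:R^-1) * dotv (c i - c j) (c i - c j) <
  (dotv (c i - c j) (c i - c j) + 2 * dotv (c i - c j) (e i)) *
  (dotv (c i - c j) (c i - c j) - 2 * dotv (c i - c j) (e j)).

(* The dual variables: [D i j = a i + a j - 2 s (i == j) + B i j + Q i j] with
   [Q = 2 s (1 - P) - 2 cert_gram] positive semidefinite, [B] vanishing inside
   the clusters and positive across them. *)
Definition cert_pot i : R := dotv (e i) (e i) + s * #|cl i|%:R^-1.

Definition cert_slack i j : R :=
  dotv (y i - y j) (y i - y j) - cert_pot i - cert_pot j + 2 * s * P i j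
  + 2 * cert_gram i j.

(** Squared distances within a cluster expand in the deviations alone, and [2 * s * P i j] cancels
    the two terms in [s] of the potentials. *)
Lemma cert_slack_same i j : cl i = cl j -> cert_slack i j = 0.
Proof.
move=> ij; rewrite /cert_slack /cert_gram /cert_pot ZpartE// ij eqxx subrr !dot0v.
rewrite !mul0r mulr0 subr0; move: (y i) (y j) (centroid y (cl j)) => u v w.
by rewrite !dotvE (dotvC v u) (dotvC w u) (dotvC w v); ring.
Qed.

Lemma cert_slack_diff i j : cl i != cl j -> 0 < cert_slack i j.
Proof.
move=> ij; have := separation ij; set g := _ - c j; set t := _ + #|cl j|%:R^-1.
have [g0|g0] := eqVneq g 0; first by rewrite g0 !dot0v !mulr0 addr0 mul0r ltxx.
have gg : 0 < dotv g g by rewrite lt_def dotv_eq0 g0 dotv_ge0.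
rewrite -ltr_pdivlMr// -subr_gt0; congr (0 < _).
rewrite /cert_slack /cert_gram /cert_pot ZpartE// (negbTE ij) mulr0 addr0 -/g.
have -> : y i - y j = g + e i - e j.
  by rewrite /g; apply/matrixP => a b; rewrite !mxE; ring.
move: (e i) (e j) => u v; rewrite /t {t}; clearbody g.
move: (#|cl i|%:R^-1) (#|cl j|%:R^-1) => p q.
rewrite !dotvE !(dotvC u g) !(dotvC v g) (dotvC v u).
by field; rewrite lt0r_neq0.
Qed.

(** Feasibility fixes row sums and trace, so the potentials and the diagonal term contribute
    constants; only two pairings with [Z] remain. *)
Lemma certificate_identity Z : PWfeasible #|G| Z ->
  \tr (distmat y *m Z) = 2 * \sum_i cert_pot i - 2 * s * #|G|%:R +
  \sum_i \sum_j cert_slack i j * Z i j +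
  \sum_i \sum_j (2 * s * ((i == j)%:R - P i j) - 2 * cert_gram i j) * Z i j.
Proof.
move=> [Z1 Ztr _ [Zs _]].
have Zsym i j : Z j i = Z i j by rewrite -[in LHS]Zs mxE.
have rowZ i : \sum_j Z i j = 1.
  move/matrixP/(_ i 0) : Z1; rewrite !mxE => <-.
  by apply: eq_bigr => l _; rewrite [X in _ * X]mxE mulr1.
have pl : \sum_i \sum_j cert_pot i * Z i j = \sum_i cert_pot i.
  by apply: eq_bigr => i _; rewrite -mulr_sumr rowZ mulr1.
have pr : \sum_i \sum_j cert_pot j * Z i j = \sum_i cert_pot i.
  rewrite exchange_big -pl; apply: eq_bigr => i _; apply: eq_bigr => j _.
  by rewrite Zsym.
have tr : \sum_i \sum_j (i == j)%:R * Z i j = #|G|%:R.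
  rewrite -Ztr; apply: eq_bigr => i _; rewrite (bigD1 i)//= eqxx mul1r big1 ?addr0// => j ji.
  by rewrite eq_sym (negbTE ji) mul0r.
rewrite mulr_natl [_ *+ 2]mulr2n -{1}pl -pr -tr mulr_sumr.
rewrite -!big_split -sumrB -!big_split; apply: eq_bigr => i _ /=.
rewrite mxE mulr_sumr -!big_split -sumrB -!big_split; apply: eq_bigr => j _ /=.
by rewrite mxE sqr_enorm Zsym /cert_slack; ring.
Qed.

Lemma cert_quadratic_ge0 Z : PWfeasible #|G| Z ->
  0 <= \sum_i \sum_j (2 * s * ((i == j)%:R - P i j) - 2 * cert_gram i j) * Z i j.
Proof.
case=> _ _ _ Zp; apply: psd_frobenius_ge0 => // v.
have := cert_gram_le v; set A := \sum_i _; set B := \sum_i _ => AB.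
suff -> : \sum_i \sum_j (2 * s * ((i == j)%:R - P i j) - 2 * cert_gram i j) * (v i * v j)
  = 2 * (s * B - A) by rewrite mulr_ge0// subr_ge0.
rewrite /A /B; move: (\sum_(S in G) N S) => s0.
rewrite mulr_sumr -sumrB mulr_sumr; apply: eq_bigr => i _.
rewrite mulr_sumr -sumrB mulr_sumr; apply: eq_bigr => j _; ring.
Qed.

Lemma cert_slack_sum_ge0 Z : PWfeasible #|G| Z ->
  forall i j, 0 <= cert_slack i j * Z i j.
Proof.
case=> _ _ Z0 _ i j; rewrite mulr_ge0//.
by have [/cert_slack_same ->//|/cert_slack_diff/ltW] := eqVneq (cl i) (cl j).
Qed.

(** Complementary slackness: [P] is orthogonal to [1 - P], and its pairing with [cert_gram] only
    involves sums of deviations over a cluster, which vanish. *)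
Lemma cert_quadratic_Zpart :
  \sum_i \sum_j (2 * s * ((i == j)%:R - P i j) - 2 * cert_gram i j) * P i j = 0.
Proof.
rewrite big1// => i _; move: (\sum_(S in G) N S) => s0.
have -> : \sum_j (2 * s0 * ((i == j)%:R - P i j) - 2 * cert_gram i j) * P i j =
  2 * s0 * (P i i - \sum_j P i j * P i j) - 2 * (\sum_j P i j * dotv (e i) (y j - c i)).
  have -> : P i i = \sum_j (i == j)%:R * P i j.
    rewrite (bigD1 i)//= eqxx mul1r big1 ?addr0// => j ji.
    by rewrite eq_sym (negbTE ji) mul0r.
  rewrite -sumrB !mulr_sumr -sumrB; apply: eq_bigr => j _.
  rewrite /cert_gram ZpartE//; case: (cl i =P cl j) => [<-|_]; last by ring.
  by rewrite subrr !dot0v !mul0r; ring.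
rewrite !sum_Zpart// -dotv_sumr sum_sub_centroid dotv0 !mulr0 subr0.
suff -> : #|cl i|%:R^-1 * (\sum_(j in cl i) P i j) = P i i by rewrite subrr mulr0.
rewrite (eq_bigr (fun=> #|cl i|%:R^-1)) => [|j].
  rewrite sumr_const -[X in _ * X]mulr_natl mulrA mulVf ?card_pblock_neq0// mul1r ZpartE//.
  by rewrite eqxx.
by rewrite (partitionT_memE _ hG) ?partitionT_pblock_in// ZpartE// eq_sym => ->.
Qed.

(** Both pairings are nonnegative and vanish at [P]. At another minimizer the slack pairing must
    vanish as well, which kills every entry across clusters and leaves [block_diagonal_feasible] to
    conclude. *)
Theorem Zpart_unique_minimizer :
  PWmin #|G| y P /\ forall Z, PWmin #|G| y Z -> Z = P.
Proof.
have Pf := @Zpart_feasible R m G hG.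
have slackP : \sum_i \sum_j cert_slack i j * P i j = 0.
  rewrite big1// => i _; rewrite big1// => j _; rewrite ZpartE//.
  by case: eqP => [/cert_slack_same ->|_]; rewrite ?mul0r ?mulr0.
have PE := certificate_identity Pf; rewrite slackP cert_quadratic_Zpart !addr0 in PE.
have slack_ge0 Z (Zf : PWfeasible #|G| Z) : 0 <= \sum_i \sum_j cert_slack i j * Z i j.
  by do 2! (apply: sumr_ge0 => ? _); exact: cert_slack_sum_ge0.
have inv0 : 0 <= (2 * m)%:R^-1 :> R by [].
split=> [|Z [Zf Zmin]].
  split=> // Z Zf; rewrite /PWobj ler_wpM2l// PE (certificate_identity Zf) -addrA lerDl.
  by rewrite addr_ge0 ?slack_ge0 ?cert_quadratic_ge0.
apply: block_diagonal_feasible => // i j ij.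
(* The index [i] rules out [m = 0], where the objective would be identically 0. *)
have m_gt0 : 0 < (2 * m)%:R^-1 :> R.
  by rewrite invr_gt0 ltr0n muln_gt0 /=; case: (m) i {j ij} => // -[].
have := Zmin _ Pf; rewrite /PWobj ler_pM2l// PE (certificate_identity Zf) -addrA gerDl.
move=> le0; have /eqP : \sum_i \sum_j cert_slack i j * Z i j = 0.
  apply/eqP; rewrite eq_le slack_ge0// andbT.
  by have := cert_quadratic_ge0 Zf; move: le0; lra.
rewrite psumr_eq0 => [/allP/(_ i (mem_index_enum _))|i' _]; last first.
  by apply: sumr_ge0 => ? _; exact: cert_slack_sum_ge0.
rewrite /= psumr_eq0 => [/allP/(_ j (mem_index_enum _))|j' _]; last exact: cert_slack_sum_ge0.
by rewrite /= mulf_eq0 gt_eqF ?cert_slack_diff// => /eqP.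
Qed.

End DualCertificate.

(** * Concentration for Bernoulli sampling *)

Section Bernoulli.
Variables (R : realType) (n : nat) (p : R).
Implicit Types (W : {set 'I_n}) (c : 'I_n -> R).
Hypothesis p01 : 0 < p <= 1.

Lemma bernoulli_weightE W :
  p ^+ #|W| * (1 - p) ^+ (n - #|W|) = \prod_i (if i \in W then p else 1 - p).
Proof.
rewrite (bigID (mem W)) /=; congr (_ * _).
  by rewrite (eq_bigr (fun=> p)) ?prodr_const// => i ->.
rewrite (eq_bigr (fun=> 1 - p)) => [|i /negbTE ->//].
rewrite (eq_bigl (mem (~: W))) => [|i]; last by rewrite !inE.
by rewrite prodr_const cardsCs finset.setCK card_ord.
Qed.

Lemma bernoulli_weight_ge0 W : 0 <= p ^+ #|W| * (1 - p) ^+ (n - #|W|).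
Proof. by case/andP: p01 => p0 p1; rewrite mulr_ge0 ?exprn_ge0 ?subr_ge0// ltW. Qed.

(** Independence in algebraic form: expanding the product on the right chooses a summand for each
    index, and the indices with [p * h i] form [W]. *)
Lemma bernoulli_expectation_prod (h : 'I_n -> R) :
  \sum_(W : {set 'I_n}) p ^+ #|W| * (1 - p) ^+ (n - #|W|) * (\prod_(i in W) h i) =
  \prod_i (p * h i + (1 - p)).
Proof.
rewrite bigA_distr; apply: eq_big => [W|W _]; first by rewrite inE.
rewrite bernoulli_weightE [X in _ * X]big_mkcond -big_split /=.
by apply: eq_bigr => i _; case: ifP => _ //; rewrite mulr1.
Qed.

Lemma bernoulli_weight_sum : \sum_(W : {set 'I_n}) p ^+ #|W| * (1 - p) ^+ (n - #|W|) = 1 :> R.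
Proof.
transitivity (\prod_(i < n) (p * 1 + (1 - p))); last first.
  by rewrite big1// => i _; rewrite mulr1 addrC subrK.
rewrite -(bernoulli_expectation_prod (fun=> 1)).
by apply: eq_bigr => W _; rewrite big1 ?mulr1.
Qed.

(** [expR x] is at most the inverse of [1 - x], and multiplying the right side by [1 - x] gives
    [1 + x ^+ 2 * (1 - 2 * x)]. *)
Lemma expR_le_quadratic (x : R) : x <= 2^-1 -> expR x <= 1 + x + 2 * x ^+ 2.
Proof.
move=> x2; have h := expR_ge1Dx (- x).
have x1 : 0 < 1 - x by lra.
have : expR x <= (1 - x)^-1.
  by rewrite -[expR x]invrK -expRN lef_pV2 ?posrE ?expR_gt0.
move/le_trans; apply; rewrite -[_^-1]mul1r ler_pdivrMr//.
have : 0 <= x ^+ 2 * (1 - 2 * x) by rewrite mulr_ge0 ?sqr_ge0//; lra.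
by lra.
Qed.

(** The parameter [t / 4] keeps each exponent below 1/2, where the quadratic bound applies. The
    second-order term then costs at most [p * N * t ^+ 2 / 8], half of what the threshold
    [t * p * N] gains. *)
Lemma bernoulli_chernoff c (N t : R) : (forall i, `|c i| <= 1) ->
  \sum_i c i ^+ 2 <= N -> 0 <= t <= 1 ->
  \sum_(W : {set 'I_n}) p ^+ #|W| * (1 - p) ^+ (n - #|W|) *
    expR (t / 4 * (\sum_(i in W) c i - p * \sum_i c i - t * p * N)) <=
  expR (- (p * N * t ^+ 2 / 8)).
Proof.
case/andP: p01 => p0 p1 c1 cN /andP[t0 t1].
pose K := expR (- (t / 4 * (p * \sum_i c i + t * p * N))).
have -> : \sum_(W : {set 'I_n}) p ^+ #|W| * (1 - p) ^+ (n - #|W|) *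
    expR (t / 4 * (\sum_(i in W) c i - p * \sum_i c i - t * p * N)) =
    K * \prod_i (p * expR (t / 4 * c i) + (1 - p)).
  rewrite -bernoulli_expectation_prod [RHS]mulr_sumr; apply: eq_bigr => W _.
  rewrite -expR_sum -mulr_sumr mulrCA -expRD; congr (_ * expR _); ring.
have h : \prod_i (p * expR (t / 4 * c i) + (1 - p)) <=
    \prod_i expR (p * (t / 4 * c i + 2 * (t / 4 * c i) ^+ 2)).
  apply: ler_prod => i _.
  rewrite addr_ge0 ?mulr_ge0 ?expR_ge0 ?(ltW p0) ?subr_ge0//=.
  apply: le_trans (expR_ge1Dx _).
  have : expR (t / 4 * c i) <= 1 + t / 4 * c i + 2 * (t / 4 * c i) ^+ 2.
    apply: expR_le_quadratic; have := c1 i; rewrite ler_norml => /andP[_ ci].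
    have : t / 4 * c i <= t / 4 * 1 by rewrite ler_wpM2l// divr_ge0.
    by lra.
  by rewrite -(ler_pM2l p0); lra.
apply: le_trans (ler_wpM2l (expR_ge0 _) h) _.
rewrite -expR_sum -mulr_sumr /K -expRD ler_expR.
have -> : \sum_i (t / 4 * c i + 2 * (t / 4 * c i) ^+ 2) =
    t / 4 * \sum_i c i + t ^+ 2 / 8 * \sum_i c i ^+ 2.
  by rewrite !mulr_sumr -big_split /=; apply: eq_bigr => i _; field.
have : p * (t ^+ 2 / 8) * \sum_i c i ^+ 2 <= p * (t ^+ 2 / 8) * N.
  by rewrite ler_wpM2l// mulr_ge0 ?(ltW p0)// divr_ge0 ?sqr_ge0.
by lra.
Qed.

(** If [E] fails at [W], some statistic deviates, and the exponential for its upper or its lower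
    tail is at least 1. The failure probability is thus at most the sum of the expectations of all
    these exponentials. *)
Lemma bernoulli_union_bound (J : finType) (A : {set J}) (c : J -> 'I_n -> R)
    (N : J -> R) (N0 t : R) (E : {set 'I_n} -> Prop) :
  0 <= t <= 1 ->
  (forall j i, j \in A -> `|c j i| <= 1) ->
  (forall j, j \in A -> \sum_i c j i ^+ 2 <= N j) ->
  (forall j, j \in A -> N0 <= N j) ->
  (forall W, (forall j, j \in A ->
     `|\sum_(i in W) c j i - p * \sum_i c j i| <= t * p * N j) -> E W) ->
  1 - (2 * #|A|)%:R * expR (- (p * N0 * t ^+ 2 / 8)) <= km_bern_prob p E.
Proof.
move=> t01 c1 cN N0N hE; have [p0 p1] := andP p01; have [t0 t1] := andP t01.
pose wt W := p ^+ #|W| * (1 - p) ^+ (n - #|W|).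
pose X (j : J) W := expR (t / 4 * (\sum_(i in W) c j i - p * \sum_i c j i - t * p * N j)).
pose Y (j : J) W := expR (t / 4 * (\sum_(i in W) - c j i - p * \sum_i - c j i - t * p * N j)).
have E0 j : j \in A -> expR (- (p * N j * t ^+ 2 / 8)) <= expR (- (p * N0 * t ^+ 2 / 8)).
  move=> jA; rewrite ler_expR lerN2.
  have : p * (t ^+ 2 / 8) * N0 <= p * (t ^+ 2 / 8) * N j.
    by rewrite ler_wpM2l ?N0N// mulr_ge0 ?(ltW p0)// divr_ge0 ?sqr_ge0.
  by lra.
have XYle : \sum_(j in A)
      (\sum_(W : {set 'I_n}) wt W * X j W + \sum_(W : {set 'I_n}) wt W * Y j W) <=
    (2 * #|A|)%:R * expR (- (p * N0 * t ^+ 2 / 8)).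
  apply: (@le_trans _ _ (\sum_(j in A) 2 * expR (- (p * N0 * t ^+ 2 / 8)))); last first.
    by rewrite sumr_const -[leLHS]mulr_natl natrM mulrCA mulrA.
  apply: ler_sum => j jA; rewrite mulr_natl mulr2n; apply: lerD.
    apply: le_trans (E0 j jA); apply: bernoulli_chernoff => //; first by move=> i; exact: c1.
    exact: cN.
  apply: le_trans (E0 j jA); apply: bernoulli_chernoff => //.
    by move=> i; rewrite normrN; exact: c1.
  by under eq_bigr do rewrite sqrrN; exact: cN.
have tot : \sum_(W : {set 'I_n}) wt W = 1 by exact: bernoulli_weight_sum.
suff : 1 - km_bern_prob p E <= \sum_(j in A)
    (\sum_(W : {set 'I_n}) wt W * X j W + \sum_(W : {set 'I_n}) wt W * Y j W).
  by move: XYle; lra.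
under eq_bigr do rewrite -big_split /=.
rewrite exchange_big /= -tot /km_bern_prob -sumrB; apply: ler_sum => W _.
have wt0 : 0 <= wt W by exact: bernoulli_weight_ge0.
have X0 j : 0 <= X j W by exact: expR_ge0.
have Y0 j : 0 <= Y j W by exact: expR_ge0.
have XY0 j : 0 <= wt W * X j W + wt W * Y j W by apply: addr_ge0; apply: mulr_ge0.
case: asboolP => [_|nE]; first by rewrite subrr sumr_ge0.
rewrite subr0.
have [/forall_inP good|] := boolP [forall j in A,
    `|\sum_(i in W) c j i - p * \sum_i c j i| <= t * p * N j].
  by exfalso; exact/nE/hE.
rewrite negb_forall_in => /exists_inP[j jA]; rewrite -ltNge => dev.
rewrite (bigD1 j)//= -[leLHS]addr0 lerD ?sumr_ge0//.
have expR_ge1 x : 0 <= x -> 1 <= expR (t / 4 * x).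
  by move=> x0; rewrite -expR0 ler_expR mulr_ge0// divr_ge0.
have [X1|Y1] : 1 <= X j W \/ 1 <= Y j W.
- move: dev; rewrite ltNge ler_norml negb_and -!ltNge => /orP[dev|dev]; [right|left].
    by apply: expR_ge1; rewrite !sumrN; move: dev; lra.
  by apply: expR_ge1; move: dev; lra.
- by rewrite -[leLHS]addr0; apply: lerD; [exact: ler_peMr|exact: mulr_ge0].
- by rewrite -[leLHS]add0r; apply: lerD; [exact: mulr_ge0|exact: ler_peMr].
Qed.

End Bernoulli.

(** * Extrema over finite families and the operator norm *)

Lemma inf_le_of_finite (R : realType) (T : finType) (F : T -> R) (E : set R) (u : R) :
  (forall v, E v -> exists i, v = F i) -> E u -> inf E <= u.
Proof.
(* An [inf] is a lower bound only for a set bounded below; minus the sum of all absolute values is a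
   bound. *)
move=> EF Eu; apply: ge_inf => //; exists (- \sum_i `|F i|) => _ /EF[i ->].
rewrite lerNl (bigD1 i)//= (le_trans (ler_norm _))// normrN lerDl.
by apply: sumr_ge0 => j _; exact: normr_ge0.
Qed.

Lemma sup_ge_of_finite (R : realType) (T : finType) (F : T -> R) (E : set R) (u : R) :
  (forall v, E v -> exists i, v = F i) -> E u -> u <= sup E.
Proof.
move=> EF Eu; apply: ub_le_sup => //; exists (\sum_i `|F i|) => _ /EF[i ->].
rewrite (bigD1 i)//= (le_trans (ler_norm _))// lerDl.
by apply: sumr_ge0 => j _; exact: normr_ge0.
Qed.

Section OperatorNorm.
Variables (R : realType) (d n : nat).
Implicit Types (A : 'M[R]_(d, n)) (v : 'cV[R]_n).

Lemma enorm_mulmx_frobenius A v :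
  enorm (A *m v) <= Num.sqrt (\sum_a \sum_j A a j ^+ 2) * enorm v.
Proof.
have F0 : 0 <= \sum_a \sum_j A a j ^+ 2.
  by apply: sumr_ge0 => a _; apply: sumr_ge0 => j _; exact: sqr_ge0.
rewrite -sqrtrM//; apply: ler_wsqrtr; rewrite mulr_suml; apply: ler_sum => a _.
by rewrite mxE -expr2 (le_trans (sum_cauchy_schwarz _ _ _)).
Qed.

Lemma opnorm_has_ubound A :
  has_ubound (fun t : R => exists v : 'cV[R]_n, enorm v = 1 /\ t = enorm (A *m v)).
Proof.
exists (Num.sqrt (\sum_a \sum_j A a j ^+ 2)) => _ [v [v1 ->]].
by rewrite (le_trans (enorm_mulmx_frobenius _ _))// v1 mulr1.
Qed.

Lemma enorm_mulmx_opnorm A v : enorm (A *m v) <= opnorm A * enorm v.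
Proof.
have [->|v0] := eqVneq v 0.
  have e0 m : enorm (0 : 'cV[R]_m) = 0 by apply/eqP; rewrite enorm_eq0.
  by rewrite mulmx0 !e0 mulr0.
have ev : 0 < enorm v by rewrite lt_def enorm_eq0 v0 enorm_ge0.
have enormZ m (k : R) (u : 'cV[R]_m) : 0 <= k -> enorm (k *: u) = k * enorm u.
  by move=> k0; rewrite /enorm dotvZl dotvZr mulrA -expr2 sqrtrM ?sqr_ge0// sqrtr_sqr ger0_norm.
rewrite -ler_pdivrMr// mulrC -enormZ ?invr_ge0 ?(ltW ev)// scalemxAr.
apply: (ub_le_sup (opnorm_has_ubound A)); exists ((enorm v)^-1 *: v); split=> //.
by rewrite enormZ ?invr_ge0 ?(ltW ev)// mulVf// gt_eqF.
Qed.

Lemma sqr_opnorm_frobenius A : opnorm A ^+ 2 <= \sum_a \sum_j A a j ^+ 2.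
Proof.
have F0 : 0 <= \sum_a \sum_j A a j ^+ 2.
  by apply: sumr_ge0 => a _; apply: sumr_ge0 => j _; exact: sqr_ge0.
set E := (fun t : R => exists v : 'cV[R]_n, enorm v = 1 /\ t = enorm (A *m v)).
(* For [n = 0] there is no unit vector, and the supremum of the empty set is 0. *)
have [[t Et]|E0] := pselect (nonempty E); last first.
  suff -> : opnorm A = 0 by rewrite expr0n.
  suff E0' : E = set0 by rewrite /opnorm -/E E0' sup0.
  by apply/eqP; apply: contrapT => /negP/set0P.
have le : opnorm A <= Num.sqrt (\sum_a \sum_j A a j ^+ 2).
  apply: ge_sup; first by exists t.
  by move=> _ [v [v1 ->]]; rewrite (le_trans (enorm_mulmx_frobenius _ _))// v1 mulr1.
have ge : 0 <= opnorm A.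
  apply: le_trans (ub_le_sup (opnorm_has_ubound A) Et).
  by case: Et => v [_ ->]; exact: enorm_ge0.
by rewrite -[leRHS]sqr_sqrtr// ler_sqr ?nnegrE ?sqrtr_ge0.
Qed.

Lemma clmat_mul (x : 'I_n -> 'cV[R]_d) (S : {set 'I_n}) v :
  clmat x S *m v = \sum_(i in S) v i 0 *: (x i - centroid x S).
Proof.
apply/matrixP => a b; rewrite (ord1 b) mxE summxE [RHS]big_mkcond.
apply: eq_bigr => i _; rewrite mxE; case: ifP => _; last by rewrite mul0r.
by rewrite [RHS]mxE mulrC.
Qed.

Lemma sqr_opnorm_clmat_le (x : 'I_n -> 'cV[R]_d) (S : {set 'I_n}) (r : R) :
  (forall i, i \in S -> enorm (x i - centroid x S) <= r) ->
  opnorm (clmat x S) ^+ 2 <= #|S|%:R * r ^+ 2.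
Proof.
move=> xr; apply: le_trans (sqr_opnorm_frobenius _) _.
rewrite exchange_big /= mulr_natl -sumr_const [leRHS]big_mkcond.
apply: ler_sum => i _; case: ifP => iS; last first.
  by rewrite big1// => a _; rewrite mxE iS expr0n.
apply: (@le_trans _ _ (enorm (x i - centroid x S) ^+ 2)).
  by rewrite sqr_enorm; apply: ler_sum => a _; rewrite mxE iS expr2.
by have h := xr i iS; rewrite ler_sqr ?nnegrE ?enorm_ge0// (le_trans (enorm_ge0 _) h).
Qed.

(** The sum is the squared norm of [v], the transposed cluster matrix applied to [u]. It also equals
    the inner product of [clmat x S *m v] with [u], so one factor [enorm v] cancels. *)
Lemma sum_sqr_dotv_opnorm (x : 'I_n -> 'cV[R]_d) (S : {set 'I_n}) (u : 'cV[R]_d) :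
  \sum_(i in S) dotv (x i - centroid x S) u ^+ 2 <=
  opnorm (clmat x S) ^+ 2 * dotv u u.
Proof.
pose v : 'cV[R]_n := \col_i (if i \in S then dotv (x i - centroid x S) u else 0).
set o := opnorm _; set q := \sum_(i in S) _.
have qv : q = dotv v v.
  rewrite /q big_mkcond; apply: eq_bigr => i _; rewrite mxE -expr2.
  by case: ifP; rewrite ?expr0n.
have qA : q = dotv (clmat x S *m v) u.
  rewrite clmat_mul dotv_suml; apply: eq_bigr => i iS.
  by rewrite dotvZl mxE iS expr2.
have h1 : q <= o * enorm v * enorm u.
  rewrite qA (le_trans (ler_dotv _ _))// ler_wpM2r ?enorm_ge0//.
  exact: enorm_mulmx_opnorm.
have [v0|v0] := eqVneq (enorm v) 0.
  by rewrite qv -sqr_enorm v0 expr0n mulr_ge0 ?sqr_ge0 ?dotv_ge0.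
have ev : 0 < enorm v by rewrite lt_def v0 enorm_ge0.
have h2 : enorm v <= o * enorm u.
  rewrite -(ler_pM2r ev) -expr2 sqr_enorm -qv (le_trans h1)//.
  by rewrite mulrAC.
rewrite qv -!sqr_enorm -exprMn ler_sqr ?nnegrE ?enorm_ge0//.
exact: le_trans (enorm_ge0 _) h2.
Qed.

End OperatorNorm.

(** * Recentering and stability of the margins *)

Lemma sum_dotv_centroid_min (R : realType) (d n : nat) (x : 'I_n -> 'cV[R]_d)
    (S : {set 'I_n}) (c u : 'cV[R]_d) :
  \sum_(i in S) dotv (x i - centroid x S) u ^+ 2 <= \sum_(i in S) dotv (x i - c) u ^+ 2.
Proof.
set z := centroid x S; set b := dotv (z - c) u.
have S0 : \sum_(i in S) dotv (x i - z) u = 0.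
  by rewrite -dotv_suml sum_sub_centroid dot0v.
have -> : \sum_(i in S) dotv (x i - c) u ^+ 2 =
    \sum_(i in S) dotv (x i - z) u ^+ 2 +
    (2 * b * \sum_(i in S) dotv (x i - z) u + \sum_(i in S) b ^+ 2).
  rewrite mulr_sumr -!big_split /=; apply: eq_bigr => i _.
  have -> : x i - c = (x i - z) + (z - c) by rewrite addrA subrK.
  by rewrite dotvDl -/b; ring.
by rewrite S0 mulr0 add0r lerDl sumr_ge0// => i _; exact: sqr_ge0.
Qed.

(* A matrix and its transpose have the same operator norm, and recentering at the
   centroid only decreases the second moments. *)
Lemma centered_combination_le (R : realType) (d n : nat) (x : 'I_n -> 'cV[R]_d)
    (S : {set 'I_n}) (c : 'cV[R]_d) (M : R) (w : 'I_n -> R) : 0 <= M ->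
  (forall u, \sum_(i in S) dotv (x i - c) u ^+ 2 <= M * dotv u u) ->
  dotv (\sum_(i in S) w i *: (x i - centroid x S))
       (\sum_(i in S) w i *: (x i - centroid x S)) <= M * \sum_(i in S) w i ^+ 2.
Proof.
move=> M0 hM; set f := \sum_(i in S) _ *: _; set q := dotv f f; set s := \sum_(i in S) _.
have s0 : 0 <= s by apply: sumr_ge0 => i _; exact: sqr_ge0.
have qE : q = \sum_(i in S) w i * dotv (x i - centroid x S) f.
  by rewrite /q {1}/f dotv_suml; apply: eq_bigr => i _; rewrite dotvZl.
(* The moment bound is tested in the direction [f] itself, and a factor [q] is then divided out. *)
have q2 : q ^+ 2 <= s * (M * q).
  rewrite {1}qE (le_trans (sum_cauchy_schwarz _ _ _))// ler_wpM2l//.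
  exact: le_trans (sum_dotv_centroid_min _ _ c f) (hM f).
have [->|q0] := eqVneq q 0; first exact: mulr_ge0.
have q_gt0 : 0 < q by rewrite lt_def q0 dotv_ge0.
by rewrite -(ler_pM2r q_gt0) -expr2 (le_trans q2)// mulrA (mulrC s).
Qed.

(** Here [b] stands for [beta] and [q] for the proximity. Moving both centroids by [q / 32] changes
    the inner product and the norm by small multiples of [q * enorm g], so half of the margin [q]
    survives. *)
Lemma margin_perturbation (R : realType) (d : nat) (y cS cT cS' cT' : 'cV[R]_d)
    (b q r : R) :
  0 <= b -> 0 < q -> 0 < enorm (cS - cT) ->
  enorm (cS' - cS) <= q / 32 -> enorm (cT' - cT) <= q / 32 ->
  enorm (y - cS) <= r -> r <= enorm (cS - cT) / 2 ->
  (b + q) * enorm (cS - cT) <= dotv (y - 2^-1 *: (cS + cT)) (cS - cT) ->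
  0 < enorm (cS' - cT') /\
  (b + q / 2) * enorm (cS' - cT') <= dotv (y - 2^-1 *: (cS' + cT')) (cS' - cT').
Proof.
move=> b0 q0 g0 ha hb hy hr hm.
set g := cS - cT in g0 hr hm *; set a := cS' - cS in ha; set e := cT' - cT in hb.
set z := y - 2^-1 *: (cS + cT) in hm.
have gE : cS' - cT' = g + (a - e).
  by rewrite /g /a /e; apply/matrixP => i j; rewrite !mxE; ring.
have zE : y - 2^-1 *: (cS' + cT') = z - 2^-1 *: (a + e).
  by rewrite /z /a /e; apply/matrixP => i j; rewrite !mxE; field.
rewrite zE gE.
have ae1 : enorm (a - e) <= q / 16.
  by have := ler_enormD a (- e); rewrite enormN; move: ha hb; lra.
have ae2 : enorm (a + e) <= q / 16.
  by have := ler_enormD a e; move: ha hb; lra.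
(* This uses that the radius is at most half the gap: the distance to the midpoint is at most the
   radius plus half the gap. *)
have zg : enorm z <= enorm g.
  have -> : z = (y - cS) + 2^-1 *: g.
    by rewrite /z /g; apply/matrixP => i j; rewrite !mxE; field.
  have := ler_enormD (y - cS) (2^-1 *: g).
  have -> : enorm (2^-1 *: g) = enorm g / 2.
    by rewrite /enorm dotvZl dotvZr mulrA -expr2 sqrtrM ?sqr_ge0// sqrtr_sqr ger0_norm// mulrC.
  by move: hy hr; lra.
have bq : b + q <= enorm g.
  rewrite -(ler_pM2r g0) (le_trans hm)// (le_trans (ler_dotv _ _))//.
  by rewrite ler_wpM2r// enorm_ge0.
have lo : enorm g <= enorm (g + (a - e)) + q / 16.
  have := ler_enormD (g + (a - e)) (- (a - e)); rewrite addrK enormN; move: ae1; lra.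
have hi : enorm (g + (a - e)) <= enorm g + q / 16.
  by have := ler_enormD g (a - e); move: ae1; lra.
split; first by move: lo bq; lra.
set g' := g + (a - e) in lo hi *.
have d1 : - (enorm g * (q / 16)) <= dotv z (a - e).
  apply: le_trans (ler_dotvN z (a - e)); rewrite lerN2.
  by apply: ler_pM; rewrite ?enorm_ge0.
have d2 : dotv (a + e) g' <= q / 16 * enorm g'.
  by rewrite (le_trans (ler_dotv _ _))// ler_wpM2r ?enorm_ge0.
have -> : dotv (z - 2^-1 *: (a + e)) g' =
    dotv z g + dotv z (a - e) - 2^-1 * dotv (a + e) g'.
  by rewrite dotvDl dotvNl dotvZl {1}/g' dotvDr.
have : (b + q / 2 + q / 32) * enorm g' <= (b + q / 2 + q / 32) * (enorm g + q / 16).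
  by rewrite ler_wpM2l//; move: b0 q0; lra.
have : (b + q / 2 + q / 32) * (q / 16) <= enorm g * (q / 16).
  by rewrite ler_wpM2r//; move: b0 q0 bq; lra.
have : 0 < q * enorm g by exact: mulr_gt0.
by move: hm d1 d2; lra.
Qed.

(** [A], [B] are cluster sizes, primed after sketching, [D] is the dimension and [O] the sum of
    squared operator norms. The rate [p] cancels up to a factor [1 - t]; since [n * tau] is at most
    [2 / pi], the errors stay well below the [q ^+ 2] contained in the expanded right side. *)
Lemma sketch_separation (R : realType) (b q t p D r n pi A B A' B' O : R) :
  0 < q -> 0 <= b -> 0 <= t <= 1 / 64 -> 0 < p -> 1 <= D -> 0 < n -> 0 < pi ->
  pi * n <= A -> pi * n <= B ->
  (1 - t) * p * A <= A' -> (1 - t) * p * B <= B' ->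
  t * D * r ^+ 2 <= q ^+ 2 * pi / 64 -> 0 <= O -> O <= n * r ^+ 2 ->
  4 * b ^+ 2 = (A^-1 + B^-1) * O ->
  p * (O + t * D * r ^+ 2 * n) * (A'^-1 + B'^-1) < 4 * (b + q / 2) ^+ 2.
Proof.
move=> q0 b0 /andP[t0 t1] p0 D1 n0 pi0 hA hB hA' hB' ht O0 On hb.
have pin : 0 < pi * n by exact: mulr_gt0.
have A0 : 0 < A by exact: lt_le_trans hA.
have B0 : 0 < B by exact: lt_le_trans hB.
have t1' : 0 < 1 - t by lra.
have tp : 0 < (1 - t) * p by exact: mulr_gt0.
have inv X X' : 0 < X -> (1 - t) * p * X <= X' -> X'^-1 <= ((1 - t) * p)^-1 * X^-1.
  move=> X0 XX'; rewrite -invfM lef_pV2 ?posrE ?mulr_gt0//.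
  by rewrite (lt_le_trans _ XX')// mulr_gt0.
set tau := A^-1 + B^-1 in hb.
have tau_le : tau * (pi * n) <= 2.
  rewrite mulrDl; have inv1 X : pi * n <= X -> X^-1 * (pi * n) <= 1.
    by move=> X0; rewrite mulrC ler_pdivrMr ?mul1r// (lt_le_trans pin).
  by have := inv1 _ hA; have := inv1 _ hB; lra.
have tau0 : 0 < tau by rewrite addr_gt0 ?invr_gt0.
set Y := O + _.
have D0 : 0 <= D by exact: le_trans D1.
have Y0 : 0 <= Y.
  apply: addr_ge0 => //; rewrite mulr_ge0 ?(ltW n0)//.
  by apply: mulr_ge0; rewrite ?sqr_ge0 ?mulr_ge0.
have step1 : p * Y * (A'^-1 + B'^-1) <= tau * Y / (1 - t).
  have -> : tau * Y / (1 - t) = p * Y * (((1 - t) * p)^-1 * A^-1 + ((1 - t) * p)^-1 * B^-1).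
    rewrite /tau; field; rewrite !lt0r_neq0//.
  rewrite ler_wpM2l ?mulr_ge0 ?(ltW p0)// lerD// inv//.
apply: le_lt_trans step1 _; rewrite ltr_pdivrMr//.
have nt : t * D * r ^+ 2 * (n * tau) <= q ^+ 2 / 32.
  have h : t * D * r ^+ 2 * (n * tau) <= q ^+ 2 * pi / 64 * (n * tau).
    by rewrite ler_wpM2r// mulr_ge0// ltW.
  have h2 : q ^+ 2 / 64 * (tau * (pi * n)) <= q ^+ 2 / 64 * 2.
    by rewrite ler_wpM2l// divr_ge0 ?sqr_ge0.
  by move: h h2; lra.
have tb : t * (4 * b ^+ 2) <= q ^+ 2 / 32.
  rewrite hb; apply: le_trans nt.
  have h : t * tau * O <= t * tau * (n * r ^+ 2).
    by rewrite ler_wpM2l// mulr_ge0// ltW.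
  have h2 : 0 <= (D - 1) * (t * r ^+ 2 * (n * tau)).
    apply: mulr_ge0; first by rewrite subr_ge0.
    apply: mulr_ge0; first by rewrite mulr_ge0 ?sqr_ge0.
    by rewrite mulr_ge0 ?ltW.
  by move: h h2; lra.
have q2 : 0 < q ^+ 2 by exact: exprn_gt0.
have tq : t * q ^+ 2 <= q ^+ 2 / 64.
  have : t * q ^+ 2 <= 1 / 64 * q ^+ 2 by rewrite ler_wpM2r// ltW.
  by lra.
have bq : 0 <= (1 - t) * (4 * (b * q)) by rewrite !mulr_ge0// ltW.
have -> : tau * Y = 4 * b ^+ 2 + t * D * r ^+ 2 * (n * tau).
  by rewrite /Y hb; ring.
by move: nt tb tq bq q2; lra.
Qed.

(** * The partition induced on the sample *)

Section SketchedPartition.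
Variables (n : nat) (G : {set {set 'I_n}}) (W : {set 'I_n}).
Hypothesis hG : finset.partition G [set: 'I_n].
Hypothesis hit : forall S, S \in G -> (0 < #|S :&: W|)%N.

Definition sketch_block (S : {set 'I_n}) : {set 'I_#|W|} := [set j | enum_val j \in S]%SET.
Definition sketch_partition : {set {set 'I_#|W|}} := (sketch_block @: G)%SET.

Lemma sum_sketch_block (V : nmodType) (S : {set 'I_n}) (F : 'I_n -> V) :
  \sum_(j in sketch_block S) F (enum_val j) = \sum_(i in S :&: W) F i.
Proof.
transitivity (\sum_(i in W | i \in S) F i).
  by rewrite big_enum_val_cond; apply: eq_bigl => j; rewrite inE.
by apply: eq_bigl => i; rewrite !inE andbC.
Qed.

Lemma card_sketch_block (S : {set 'I_n}) : #|sketch_block S| = #|S :&: W|.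
Proof. rewrite -[LHS]sum1_card -[RHS]sum1_card; transitivity (\sum_(i in W | i \in S) 1)%N.
  by rewrite big_enum_val_cond; apply: eq_bigl => j; rewrite inE.
by apply: eq_bigl => i; rewrite !inE andbC. Qed.

Lemma centroid_sketch_block (R : realType) (d : nat) (x : 'I_n -> 'cV[R]_d) (S : {set 'I_n}) :
  centroid (sketch x (W := W)) (sketch_block S) = centroid x (S :&: W).
Proof. by rewrite /centroid card_sketch_block sum_sketch_block. Qed.

Lemma sketch_block_mem (S : {set 'I_n}) : S \in G -> exists j, j \in sketch_block S.
Proof. by move=> SG; apply/card_gt0P; rewrite card_sketch_block hit. Qed.

Lemma sketch_block_inj : {in G &, injective sketch_block}.
Proof.
move=> S T SG TG ST; have [j jS] := sketch_block_mem SG.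
have : j \in sketch_block T by rewrite -ST.
move: jS; rewrite !inE => jS jT.
move: jS jT; rewrite (partitionT_memE _ hG SG) (partitionT_memE _ hG TG).
by move=> /eqP <- /eqP.
Qed.

Lemma card_sketch_partition : #|sketch_partition| = #|G|.
Proof. by rewrite card_in_imset//; exact: sketch_block_inj. Qed.

Lemma sketch_partitionP : finset.partition sketch_partition [set: 'I_#|W|].
Proof.
apply/and3P; split.
- apply/eqP/setP => j; rewrite inE; apply/bigcupP.
  exists (sketch_block (finset.pblock G (enum_val j))).
    by rewrite imset_f// partitionT_pblock_in.
  by rewrite inE partitionT_mem_pblock.
- apply/finset.trivIsetP => _ _ /imsetP[S SG ->] /imsetP[T TG ->] ST.
  rewrite -setI_eq0; apply/eqP/setP => j; rewrite !inE.
  apply/negP => /andP[]; rewrite (partitionT_memE _ hG SG) (partitionT_memE _ hG TG).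
  by move=> /eqP jS /eqP jT; rewrite -jS -jT eqxx in ST.
- apply/negP => /imsetP[S SG /esym S0]; have [j] := sketch_block_mem SG.
  by rewrite S0 inE.
Qed.

Lemma pblock_sketch_partition j :
  finset.pblock sketch_partition j = sketch_block (finset.pblock G (enum_val j)).
Proof.
have [_ tG _] := and3P sketch_partitionP; apply: def_pblock => //.
  by rewrite imset_f// partitionT_pblock_in.
by rewrite inE partitionT_mem_pblock.
Qed.

End SketchedPartition.

(** * Deterministic recovery when the empirical moments are accurate *)

Section GoodSketch.
Variables (R : realType) (d n : nat) (x : 'I_n -> 'cV[R]_d) (G : {set {set 'I_n}}).
Variables (W : {set 'I_n}) (p t r q pi : R).
Local Notation c S := (centroid x S).
Local Notation c' S := (centroid x (S :&: W)).
Hypothesis hG : finset.partition G [set: 'I_n].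
Hypothesis d_gt0 : (0 < d)%N.
Hypothesis p_gt0 : 0 < p.
Hypothesis t01 : 0 <= t <= 1 / 64.
Hypothesis q_gt0 : 0 < q.
Hypothesis pi_gt0 : 0 < pi.
Hypothesis hr : forall S i, S \in G -> i \in S -> enorm (x i - c S) <= r.
Hypothesis hpi : forall S, S \in G -> pi * n%:R <= #|S|%:R.
Hypothesis margin : forall S T i, S \in G -> T \in G -> S != T -> i \in S ->
  (beta x G S T + q) * enorm (c S - c T) <=
  dotv (x i - 2^-1 *: (c S + c T)) (c S - c T).
Hypothesis gap_gt0 : forall S T, S \in G -> T \in G -> S != T -> 0 < enorm (c S - c T).
Hypothesis gap_rad : forall S T, S \in G -> T \in G -> S != T -> r <= enorm (c S - c T) / 2.
Hypothesis small_shift : t * r * d%:R * 2 <= q / 32.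
Hypothesis small_cov : t * d%:R * r ^+ 2 <= q ^+ 2 * pi / 64.
Hypothesis dev_card : forall S, S \in G ->
  `|#|S :&: W|%:R - p * #|S|%:R| <= t * p * #|S|%:R.
Hypothesis dev_mean : forall S a, S \in G ->
  `|\sum_(i in S :&: W) (x i - c S) a 0| <= t * p * #|S|%:R * r.
Hypothesis dev_cov : forall S a b, S \in G ->
  `|\sum_(i in S :&: W) (x i - c S) a 0 * (x i - c S) b 0
    - p * \sum_(i in S) (x i - c S) a 0 * (x i - c S) b 0| <= t * p * #|S|%:R * r ^+ 2.

Lemma cluster_size_gt0 S : S \in G -> 0 < #|S|%:R :> R.
Proof. by move=> SG; rewrite ltr0n (partitionT_card_gt0 hG). Qed.

Lemma cluster_rad_ge0 S : S \in G -> 0 <= r.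
Proof.
move=> SG; have /card_gt0P[i iS] := partitionT_card_gt0 hG SG.
exact: le_trans (enorm_ge0 _) (hr SG iS).
Qed.

Lemma sketch_size_ge S : S \in G -> (1 - t) * p * #|S|%:R <= #|S :&: W|%:R.
Proof. by move=> /dev_card; rewrite ler_norml => /andP[h _]; move: h; lra. Qed.

Lemma sketch_size_gt0 S : S \in G -> 0 < #|S :&: W|%:R :> R.
Proof.
move=> SG; apply: lt_le_trans (sketch_size_ge SG).
by rewrite !mulr_gt0 ?cluster_size_gt0//; move: t01; lra.
Qed.

Lemma sketch_hit S : S \in G -> (0 < #|S :&: W|)%N.
Proof. by move=> /sketch_size_gt0; rewrite ltr0n. Qed.

(** Dividing the deviation of a coordinate sum by the sketched size, at least [(1 - t) * p * #|S|],
    gives at most [2 * t * r] per coordinate. *)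
Lemma centroid_shift S : S \in G -> enorm (c' S - c S) <= q / 32.
Proof.
move=> SG; apply: le_trans small_shift.
have r0 := cluster_rad_ge0 SG; have [t0 t1] := andP t01.
have -> : t * r * d%:R * 2 = d%:R * (2 * t * r) by ring.
apply: ler_enorm_coord => [|a]; first by rewrite !mulr_ge0.
have -> : (c' S - c S) a 0 = #|S :&: W|%:R^-1 * \sum_(i in S :&: W) (x i - c S) a 0.
  have -> : c' S - c S = #|S :&: W|%:R^-1 *: \sum_(i in S :&: W) (x i - c S).
    rewrite sumrB sumr_const scalerBr -[c S *+ _]scaler_nat scalerA mulVf ?scale1r//.
    by rewrite lt0r_neq0// sketch_size_gt0.
  by rewrite mxE summxE.
have S'0 := sketch_size_gt0 SG.
rewrite normrM ger0_norm ?invr_ge0 ?ler0n// mulrC ler_pdivrMr//.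
apply: le_trans (dev_mean a SG) _.
have : 2 * t * r * ((1 - t) * p * #|S|%:R) <= 2 * t * r * #|S :&: W|%:R.
  by rewrite ler_wpM2l ?sketch_size_ge// !mulr_ge0.
have : 0 <= (t * r) * (p * #|S|%:R) * (1 - 2 * t).
  by rewrite !mulr_ge0 ?(ltW p_gt0)//; move: t01; lra.
by lra.
Qed.

Lemma sketch_margin S T i : S \in G -> T \in G -> S != T -> i \in S ->
  0 < enorm (c' S - c' T) /\
  (beta x G S T + q / 2) * enorm (c' S - c' T) <=
    dotv (x i - 2^-1 *: (c' S + c' T)) (c' S - c' T).
Proof.
move=> SG TG ST iS; apply: (@margin_perturbation _ _ _ (c S) (c T) _ _ _ _ r) => //.
- by rewrite mulr_ge0// sqrtr_ge0.
- exact: gap_gt0.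
- exact: centroid_shift.
- exact: centroid_shift.
- exact: hr.
- exact: gap_rad.
- exact: margin.
Qed.

(** The scaled squared norm of the full cluster plus the sampling error; it serves as [N] in the
    certificate. *)
Definition sketch_opbound (S : {set 'I_n}) : R :=
  p * (opnorm (clmat x S) ^+ 2 + t * d%:R * r ^+ 2 * #|S|%:R).

Lemma sketch_opbound_ge0 S : 0 <= sketch_opbound S.
Proof.
have [t0 t1] := andP t01.
apply: mulr_ge0; first exact: ltW.
apply: addr_ge0; first exact: sqr_ge0.
by apply: mulr_ge0 => //; apply: mulr_ge0; rewrite ?sqr_ge0 ?mulr_ge0.
Qed.

(** Entrywise covariance errors cost their common bound times the squared l1 norm of [u], which is
    at most [d] times the squared Euclidean norm. *)
Lemma sketch_cov_le S (u : 'cV[R]_d) : S \in G ->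
  \sum_(i in S :&: W) dotv (x i - c S) u ^+ 2 <= sketch_opbound S * dotv u u.
Proof.
move=> SG; have [t0 t1] := andP t01.
have quad (A : {set 'I_n}) : \sum_(i in A) dotv (x i - c S) u ^+ 2 =
    \sum_a \sum_b u a 0 * u b 0 * \sum_(i in A) (x i - c S) a 0 * (x i - c S) b 0.
  transitivity (\sum_(i in A) \sum_a \sum_b
      u a 0 * u b 0 * ((x i - c S) a 0 * (x i - c S) b 0)).
    apply: eq_bigr => i _; rewrite expr2 mulr_suml; apply: eq_bigr => a _.
    by rewrite mulr_sumr; apply: eq_bigr => b _; ring.
  rewrite exchange_big; apply: eq_bigr => a _; rewrite exchange_big.
  by apply: eq_bigr => b _; rewrite mulr_sumr.
set K := t * p * #|S|%:R * r ^+ 2.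
have K0 : 0 <= K by rewrite /K; apply: mulr_ge0; rewrite ?sqr_ge0 ?mulr_ge0 ?(ltW p_gt0).
have dev : \sum_(i in S :&: W) dotv (x i - c S) u ^+ 2 -
    p * \sum_(i in S) dotv (x i - c S) u ^+ 2 <= K * (\sum_a `|u a 0|) ^+ 2.
  rewrite !quad expr2 mulr_suml !mulr_sumr -sumrB; apply: ler_sum => a _.
  rewrite !mulr_sumr -sumrB; apply: ler_sum => b _.
  rewrite mulrCA -mulrBr (le_trans (ler_norm _))// normrM normrM mulrC.
  by rewrite ler_wpM2r ?mulr_ge0// dev_cov.
have l1 : (\sum_a `|u a 0|) ^+ 2 <= d%:R * dotv u u.
  have -> : \sum_a `|u a 0| = \sum_a 1 * `|u a 0| by apply: eq_bigr => a _; rewrite mul1r.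
  apply: le_trans (sum_cauchy_schwarz _ _ _) _.
  have -> : dotv u u = \sum_a `|u a 0| ^+ 2.
    by apply: eq_bigr => a _; rewrite real_normK ?num_real.
  by under eq_bigr do rewrite expr1n; rewrite sumr_const card_ord.
have : p * \sum_(i in S) dotv (x i - c S) u ^+ 2 <=
    p * (opnorm (clmat x S) ^+ 2 * dotv u u).
  by rewrite ler_wpM2l ?(ltW p_gt0)// sum_sqr_dotv_opnorm.
have : K * (\sum_a `|u a 0|) ^+ 2 <= K * (d%:R * dotv u u) by rewrite ler_wpM2l.
by move: dev; rewrite /sketch_opbound /K; lra.
Qed.

Lemma sum_sketch_opbound :
  \sum_(S in G) sketch_opbound S =
  p * (\sum_(S in G) opnorm (clmat x S) ^+ 2 + t * d%:R * r ^+ 2 * n%:R).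
Proof.
rewrite /sketch_opbound -mulr_sumr big_split /= -mulr_sumr -natr_sum.
by rewrite -(card_partition hG) cardsT card_ord.
Qed.

Lemma sketch_opbound_separation S T : S \in G -> T \in G -> S != T ->
  (\sum_(Q in G) sketch_opbound Q) * (#|S :&: W|%:R^-1 + #|T :&: W|%:R^-1) <
  4 * (beta x G S T + q / 2) ^+ 2.
Proof.
move=> SG TG ST; rewrite sum_sketch_opbound.
have b0 : 0 <= beta x G S T by rewrite mulr_ge0// sqrtr_ge0.
have O0 : 0 <= \sum_(Q in G) opnorm (clmat x Q) ^+ 2.
  by apply: sumr_ge0 => Q _; exact: sqr_ge0.
apply: (@sketch_separation _ _ _ _ _ _ _ _ pi #|S|%:R #|T|%:R) => //;
  rewrite ?hpi ?sketch_size_ge//.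
- by rewrite ler1n.
- rewrite ltr0n; have /card_gt0P[[m mn] _] := partitionT_card_gt0 hG SG.
  exact: leq_ltn_trans mn.
- apply: (@le_trans _ _ (\sum_(Q in G) #|Q|%:R * r ^+ 2)).
    by apply: ler_sum => Q QG; apply: sqr_opnorm_clmat_le => i; exact: hr.
  by rewrite -mulr_suml -natr_sum -(card_partition hG) cardsT card_ord.
- rewrite /beta exprMn sqr_sqrtr.
    by rewrite mulrA [X in X * _ = _](_ : _ = 1) ?mul1r//; field.
  by rewrite mulr_ge0// addr_ge0.
Qed.

(** A positive inner product of [x i] minus the midpoint with [c' S - c' T] means being closer to
    [c' S]. The margin holds for all points of [S], sampled or not. *)
Lemma sketch_closest i : closest x (sketch_partition G W) i (sketch_block W (finset.pblock G i)).
Proof.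
split=> [|_ /imsetP[T TG ->] Tne]; first by rewrite imset_f// partitionT_pblock_in.
set S := finset.pblock G i; have SG : S \in G by exact: partitionT_pblock_in.
have ST : S != T by apply: contraNneq Tne => <-.
have [g0 gm] := sketch_margin SG TG ST (partitionT_mem_pblock i hG).
rewrite !centroid_sketch_block -ltr_sqr ?nnegrE ?enorm_ge0// !sqr_enorm.
have b0 : 0 <= beta x G S T by rewrite mulr_ge0// sqrtr_ge0.
have : 0 < (beta x G S T + q / 2) * enorm (c' S - c' T).
  by rewrite mulr_gt0// ltr_wpDl// divr_gt0.
move/lt_le_trans => /(_ _ gm).
move: (x i) (c' S) (c' T) => y a b.
rewrite !dotvE (dotvC y a) (dotvC y b) (dotvC b a); lra.
Qed.

Lemma sketch_closest_unique i S' :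
  closest x (sketch_partition G W) i S' -> S' = sketch_block W (finset.pblock G i).
Proof.
move=> [S'G S'c]; have [SG Sc] := sketch_closest i.
apply/eqP; apply: contraT => ne.
have := lt_trans (S'c _ SG _) (Sc _ S'G ne); rewrite ltxx; apply.
by rewrite eq_sym.
Qed.

Lemma sketch_assignment : assignment_recovers x G (sketch_partition G W).
Proof.
split=> [i|i j S' T' /sketch_closest_unique -> /sketch_closest_unique ->].
  by exists (sketch_block W (finset.pblock G i)); exact: sketch_closest.
split=> [|->//]; apply: (sketch_block_inj hG sketch_hit); exact: partitionT_pblock_in.
Qed.

Lemma sketch_exact_recovery : km_exact_recovery #|G| x G W.
Proof.
(* The bound must be indexed by blocks of the sketch; as [sketch_block] is injective on [G], the sum
   has a single term. *)
pose N (S' : {set 'I_#|W|}) := \sum_(S in G | sketch_block W S == S') sketch_opbound S.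
have inj := sketch_block_inj hG sketch_hit.
have NE S : S \in G -> N (sketch_block W S) = sketch_opbound S.
  move=> SG; rewrite /N (bigD1 S) ?SG ?eqxx//= big1 ?addr0// => T.
  by case/andP => /andP[TG /eqP/inj -> //]; rewrite eqxx.
have G'P := sketch_partitionP hG sketch_hit.
have sN : \sum_(S' in sketch_partition G W) N S' = \sum_(S in G) sketch_opbound S.
  by rewrite big_imset//=; apply: eq_bigr => S; exact: NE.
have [Pmin Puniq] :
    PWmin #|sketch_partition G W| (sketch x (W := W)) (Zpart R (sketch_partition G W)) /\
    forall Z, PWmin #|sketch_partition G W| (sketch x (W := W)) Z ->
      Z = Zpart R (sketch_partition G W).
  apply: (@Zpart_unique_minimizer _ _ _ _ _ N) => //.
  - by move=> S' _; apply: sumr_ge0 => S _; exact: sketch_opbound_ge0.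
  - move=> _ w /imsetP[S SG ->]; rewrite NE//.
    (* The covariances are controlled around the full centroid [c S], not around the sketched
       one. *)
    apply: (centered_combination_le (c := c S)) => [|u]; first exact: sketch_opbound_ge0.
    apply: le_trans (sketch_cov_le u SG).
    by rewrite -(sum_sketch_block W S (fun i => dotv (x i - c S) u ^+ 2)).
  - move=> i j; rewrite sN !pblock_sketch_partition//; try exact: sketch_hit.
    set S := finset.pblock G _; set T := finset.pblock G _ => ST'.
    have ST : S != T by apply: contraNneq ST' => ->.
    have SG : S \in G by exact: partitionT_pblock_in.
    have TG : T \in G by exact: partitionT_pblock_in.
    rewrite !card_sketch_block !centroid_sketch_block /sketch.
    have [g0 mS] := sketch_margin SG TG ST (partitionT_mem_pblock (enum_val i) hG).
    have TS : T != S by rewrite eq_sym.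
    have [_ mT] := sketch_margin TG SG TS (partitionT_mem_pblock (enum_val j) hG).
    have b0 : 0 <= beta x G S T by rewrite mulr_ge0// sqrtr_ge0.
    have bC : beta x G T S = beta x G S T by rewrite /beta addrC.
    have bq : 0 < beta x G S T + q / 2 by rewrite ltr_wpDl// divr_gt0.
    rewrite bC -(opprB (c' S) (c' T)) enormN dotvNr (addrC (c' T)) in mT.
    have sep := sketch_opbound_separation SG TG ST.
    set g := c' S - c' T in g0 mS mT *; set b := beta x G S T + q / 2 in mS mT bq sep.
    apply: (@lt_le_trans _ _ (4 * b ^+ 2 * dotv g g)).
      by rewrite ltr_pM2r// -sqr_enorm exprn_gt0.
    (* Each factor of the separation product is twice a margin, that of [i] seen from [S] and that
       of [j] seen from [T]. *)
    have -> : 4 * b ^+ 2 * dotv g g = (2 * (b * enorm g)) * (2 * (b * enorm g)).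
      by rewrite -sqr_enorm; ring.
    have bg0 : 0 <= 2 * (b * enorm g) by rewrite !mulr_ge0// ltW.
    apply: ler_pM => //.
      apply: le_trans (ler_wpM2l _ mS) _ => //; rewrite le_eqVlt; apply/orP; left; apply/eqP.
      rewrite /g; move: (x _) (c' S) (c' T) => y a e.
      by rewrite !dotvE (dotvC y a) (dotvC y e) (dotvC e a); field.
    apply: le_trans (ler_wpM2l _ mT) _ => //; rewrite le_eqVlt; apply/orP; left; apply/eqP.
    rewrite /g; move: (x _) (c' S) (c' T) => y a e.
    by rewrite !dotvE (dotvC y a) (dotvC y e) (dotvC e a); field.
rewrite card_sketch_partition// in Pmin Puniq; last exact: sketch_hit.
split=> [|Z /Puniq ->]; first by exists (Zpart R (sketch_partition G W)).
exists (sketch_partition G W); split=> //; last exact: sketch_assignment.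
by rewrite card_sketch_partition//; exact: sketch_hit.
Qed.

End GoodSketch.

(** * The extremal quantities as pointwise bounds *)

Section ShapeParameters.
Variables (R : realType) (d n : nat) (x : 'I_n -> 'cV[R]_d) (G : {set {set 'I_n}}).
Local Notation c S := (centroid x S).

Lemma km_rad_ge S i : S \in G -> i \in S -> enorm (x i - c S) <= km_rad x G.
Proof.
move=> SG iS; apply: (@sup_ge_of_finite R ({set 'I_n} * 'I_n)%type
  (fun q => enorm (x q.2 - c q.1))); last by exists S, i.
by move=> _ [S' [i' [_ [_ ->]]]]; exists (S', i').
Qed.

Lemma km_Delta_le S T : S \in G -> T \in G -> S != T -> km_Delta x G <= enorm (c S - c T).
Proof.
move=> SG TG ST; apply: (@inf_le_of_finite R ({set 'I_n} * {set 'I_n})%type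
  (fun q => enorm (c q.1 - c q.2))); last by exists S, T.
by move=> _ [S' [T' [_ [_ [_ ->]]]]]; exists (S', T').
Qed.

Lemma km_pimin_le S : (0 < n)%N -> S \in G -> km_pimin R G * n%:R <= #|S|%:R.
Proof.
move=> n0 SG; rewrite -ler_pdivlMr ?ltr0n//.
apply: (@inf_le_of_finite R {set 'I_n} (fun S => #|S|%:R / n%:R)); last by exists S.
by move=> _ [S' [_ ->]]; exists S'.
Qed.

Lemma km_pimin_gt0 : finset.partition G [set: 'I_n] -> (0 < n)%N -> 0 < km_pimin R G.
Proof.
move=> hG n0; apply: (@lt_le_trans _ _ n%:R^-1); first by rewrite invr_gt0 ltr0n.
apply: lb_le_inf.
  pose S := finset.pblock G (Ordinal n0).
  by exists (#|S|%:R / n%:R), S; split=> //; exact: partitionT_pblock_in.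
move=> _ [S [SG ->]]; rewrite ler_peMl ?invr_ge0// ler1n.
exact: (partitionT_card_gt0 hG).
Qed.

Lemma km_pimin_le1 : finset.partition G [set: 'I_n] -> (0 < n)%N -> km_pimin R G <= 1.
Proof.
move=> hG n0; have SG := partitionT_pblock_in (Ordinal n0) hG.
rewrite -(@ler_pM2r _ n%:R) ?ltr0n// mul1r (le_trans (km_pimin_le n0 SG))//.
by rewrite ler_nat -[leqRHS]card_ord max_card.
Qed.

Lemma km_prox_margin S T i : 0 < km_prox x G -> S \in G -> T \in G -> S != T -> i \in S ->
  0 < enorm (c S - c T) /\
  (beta x G S T + km_prox x G) * enorm (c S - c T) <=
    dotv (x i - 2^-1 *: (c S + c T)) (c S - c T).
Proof.
move=> q0 SG TG ST iS; set g := c S - c T.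
have h1 : km_prox x G <= alpha x S T - beta x G S T.
  apply: (@inf_le_of_finite R ({set 'I_n} * {set 'I_n})%type
    (fun q => alpha x q.1 q.2 - beta x G q.1 q.2)); last by exists S, T.
  by move=> _ [S' [T' [_ [_ [_ ->]]]]]; exists (S', T').
have h2 : alpha x S T <= dotv (x i - 2^-1 *: (c S + c T)) ((enorm g)^-1 *: g).
  apply: (@inf_le_of_finite R 'I_n
    (fun i => dotv (x i - 2^-1 *: (c S + c T)) ((enorm g)^-1 *: g))); last by exists i.
  by move=> _ [i' [_ ->]]; exists i'.
have b0 : 0 <= beta x G S T by rewrite mulr_ge0// sqrtr_ge0.
have g0 : g != 0.
  (* Coincident centroids would give the direction 0, hence [alpha] at most 0, against the positive
     proximity. *)
  by apply/eqP => g0; move: h2; rewrite g0 scaler0 dotv0; move: h1 b0 q0; lra.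
have eg0 : 0 < enorm g by rewrite lt_def enorm_eq0 g0 enorm_ge0.
split=> //; rewrite -ler_pdivlMr// mulrC -dotvZr.
by move: h1 h2; lra.
Qed.

End ShapeParameters.

(* With [None] standing for the constant function 1, products of two features
   cover cluster sizes, coordinate sums and covariances at once. *)
Definition sketch_feature (R : realType) (d n : nat) (x : 'I_n -> 'cV[R]_d) (r : R)
    (S : {set 'I_n}) (o : option 'I_d) (i : 'I_n) : R :=
  if o is Some a then (x i - centroid x S) a 0 / r else 1.

Definition sketch_statistic (R : realType) (d n : nat) (x : 'I_n -> 'cV[R]_d) (r : R)
    (q : {set 'I_n} * (option 'I_d * option 'I_d)) (i : 'I_n) : R :=
  if i \in q.1 then sketch_feature x r q.1 q.2.1 i * sketch_feature x r q.1 q.2.2 i else 0.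

(** * Probability of accurate moments *)

Section RecoveryProbability.
Variables (R : realType) (d n : nat) (x : 'I_n -> 'cV[R]_d) (G : {set {set 'I_n}}).
Local Notation c S := (centroid x S).
Local Notation r := (km_rad x G).
Local Notation prox := (km_prox x G).
Local Notation pi := (km_pimin R G).
Hypothesis hG : finset.partition G [set: 'I_n].
Hypothesis d_gt0 : (0 < d)%N.
Hypothesis n_gt0 : (0 < n)%N.
Hypothesis prox_gt0 : 0 < prox.
Hypothesis rad_Delta : r <= km_Delta x G / 2.

Lemma normr_sketch_feature S o i : S \in G -> i \in S -> `|sketch_feature x r S o i| <= 1.
Proof.
move=> SG iS; case: o => [a|] /=; last by rewrite normr1.
have er := le_trans (ler_coord_enorm (x i - c S) a) (km_rad_ge x SG iS).
have [->|r0] := eqVneq r 0; first by rewrite invr0 mulr0 normr0.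
have r_gt0 : 0 < r by rewrite lt_def r0 (le_trans _ er).
by rewrite normrM normfV (gtr0_norm r_gt0) ler_pdivrMr// mul1r.
Qed.

(** For [r = 0] the division returns 0, which is still right because every deviation vanishes. *)
Lemma sketch_featureK S a i : S \in G -> i \in S ->
  sketch_feature x r S (Some a) i * r = (x i - c S) a 0.
Proof.
move=> SG iS /=; have [r0|r0] := eqVneq r 0; last by rewrite divfK.
have := le_trans (ler_coord_enorm (x i - c S) a) (km_rad_ge x SG iS).
by rewrite r0 mulr0 normr_le0 => /eqP ->.
Qed.

Lemma recovery_of_small_deviations (p t : R) (W : {set 'I_n}) :
  0 < p -> 0 <= t <= 1 / 64 ->
  t * r * d%:R * 2 <= prox / 32 -> t * d%:R * r ^+ 2 <= prox ^+ 2 * pi / 64 ->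
  (forall q, q \in finset.setX G [set: option 'I_d * option 'I_d] ->
    `|\sum_(i in W) sketch_statistic x r q i - p * \sum_i sketch_statistic x r q i|
      <= t * p * #|q.1|%:R) ->
  km_exact_recovery #|G| x G W.
Proof.
move=> p0 t01 ht1 ht2 hdev.
have {}hdev S o o' : S \in G ->
    `|\sum_(i in S :&: W) sketch_feature x r S o i * sketch_feature x r S o' i
     - p * \sum_(i in S) sketch_feature x r S o i * sketch_feature x r S o' i|
    <= t * p * #|S|%:R.
  move=> SG; have := hdev (S, (o, o')); rewrite !inE SG => /(_ isT).
  rewrite /sketch_statistic /= -!big_mkcond -big_mkcondr /=.
  by congr (`|_ - _| <= _); apply: eq_bigl => i; rewrite !inE andbC.
have r0 : 0 <= r.
  have /card_gt0P[i iS] := partitionT_card_gt0 hG (partitionT_pblock_in (Ordinal n_gt0) hG).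
  exact: le_trans (enorm_ge0 _) (km_rad_ge x (partitionT_pblock_in (Ordinal n_gt0) hG) iS).
apply: (@sketch_exact_recovery _ _ _ _ _ _ p t r prox pi) => //.
- exact: km_pimin_gt0.
- by move=> S i; exact: km_rad_ge.
- by move=> S; exact: km_pimin_le.
- by move=> S T i SG TG ST iS; have [] := km_prox_margin prox_gt0 SG TG ST iS.
- move=> S T SG TG ST; have /card_gt0P[i iS] := partitionT_card_gt0 hG SG.
  by have [] := km_prox_margin prox_gt0 SG TG ST iS.
- move=> S T SG TG ST; apply: le_trans rad_Delta _.
  by rewrite ler_pM2r ?invr_gt0// km_Delta_le.
- move=> S SG; have := hdev S None None SG => /=.
  by rewrite mulr1 !sumr_const.
- move=> S a SG; have := hdev S (Some a) None SG.
  have e0 : \sum_(i in S) (x i - c S) a 0 = 0.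
    by have /matrixP/(_ a 0) := sum_sub_centroid x S; rewrite summxE mxE.
  (* Centering makes the expected coordinate sum 0, so the deviation is the sampled sum itself. *)
  have -> : \sum_(i in S) sketch_feature x r S (Some a) i * sketch_feature x r S None i = 0.
    rewrite (eq_bigr (fun i => (x i - c S) a 0 / r)) => [|i _]; last by rewrite /= mulr1.
    by rewrite -mulr_suml e0 mul0r.
  rewrite mulr0 subr0 => h; apply: le_trans (ler_wpM2r r0 h).
  rewrite -[X in _ <= _ * X](ger0_norm r0) -normrM mulr_suml.
  rewrite [leRHS](_ : _ = `|\sum_(i in S :&: W) (x i - c S) a 0|)//.
  congr `|_|; apply: eq_bigr => i; rewrite inE => /andP[iS _].
  by rewrite [X in _ * X * _]/= mulr1 sketch_featureK.
- move=> S a b SG; have h := hdev S (Some a) (Some b) SG.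
  have r20 : 0 <= r ^+ 2 by exact: sqr_ge0.
  apply: le_trans (ler_wpM2r r20 h).
  rewrite -[X in _ <= _ * X](ger0_norm r20) -normrM mulrBl -mulrA !mulr_suml.
  have fE i : i \in S ->
      sketch_feature x r S (Some a) i * sketch_feature x r S (Some b) i * r ^+ 2 =
      (x i - c S) a 0 * (x i - c S) b 0.
    by move=> iS; rewrite -!(sketch_featureK _ SG iS); ring.
  rewrite le_eqVlt; apply/orP; left; apply/eqP; congr (`|_ - _ * _|).
    by apply: eq_bigr => i; rewrite inE => /andP[iS _]; rewrite fE.
  by apply: eq_bigr => i iS; rewrite fE.
Qed.

Lemma recovery_probability_ge (p t : R) :
  0 < p <= 1 -> 0 <= t <= 1 / 64 ->
  t * r * d%:R * 2 <= prox / 32 -> t * d%:R * r ^+ 2 <= prox ^+ 2 * pi / 64 ->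
  1 - (2 * (#|G| * d.+1 ^ 2))%:R * expR (- (p * (pi * n%:R) * t ^+ 2 / 8)) <=
  km_bern_prob p (km_exact_recovery #|G| x G).
Proof.
move=> p01 t01 ht1 ht2; have [p0 p1] := andP p01; have [t0 t1] := andP t01.
have -> : (#|G| * d.+1 ^ 2)%N = #|finset.setX G [set: option 'I_d * option 'I_d]|.
  by rewrite cardsX cardsT card_prod card_option card_ord.
apply: (@bernoulli_union_bound R n p p01 _ _ (sketch_statistic x r)
  (fun q => #|q.1|%:R) (pi * n%:R) t).
- by rewrite t0; move: t1; lra.
- move=> [S [a b]] i; rewrite !inE andbT /= => SG; rewrite /sketch_statistic /=.
  case: ifP => iS; last by rewrite normr0.
  by rewrite normrM mulr_ile1 ?normr_sketch_feature.
- move=> [S [a b]]; rewrite !inE andbT /= => SG.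
  rewrite -sumr_const [leRHS]big_mkcond; apply: ler_sum => i _.
  rewrite /sketch_statistic /=; case: ifP => iS; last by rewrite expr0n.
  rewrite -(real_normK (num_real _)) expr_le1// normrM mulr_ile1 ?normr_sketch_feature//.
- by move=> [S q]; rewrite !inE andbT /=; exact: km_pimin_le.
- by move=> W; exact: recovery_of_small_deviations.
Qed.

End RecoveryProbability.

(** * The explicit shape parameter *)

Definition clip1 (R : realType) (c : \bar R) : R :=
  match c with
  | EFin a => Num.min a 1
  | EPInf => 1
  | ENInf => 0
  end.

Lemma clip1_gt0 (R : realType) (c : \bar R) : (0 < c)%E -> 0 < clip1 c.
Proof. by case: c => //= a; rewrite lte_fin lt_min ltr01 andbT. Qed.

Lemma clip1_le1 (R : realType) (c : \bar R) : clip1 c <= 1.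
Proof. by case: c => //= a; rewrite ge_min lexx orbT. Qed.

Lemma le_clip1 (R : realType) (c1 c2 : \bar R) :
  (0 < c1)%E -> (c1 <= c2)%E -> clip1 c1 <= clip1 c2.
Proof.
case: c1 c2 => [a| |] [b| |] //=; rewrite ?lee_fin => _ ab.
  by rewrite le_min !ge_min ab lexx orbT.
by rewrite ge_min lexx orbT.
Qed.

(** The product form of the bound also covers [b = 0], where the ratio is infinite and clips to
    1. *)
Lemma clip1_ratio (R : realType) (a b : R) : 0 < a -> 0 <= b ->
  (0 < km_ratio a b)%E /\ clip1 (km_ratio a b) * b <= a.
Proof.
move=> a0 b0; rewrite /km_ratio; have [->|bn0] := eqVneq b 0.
  by rewrite mulr0 ltW.
have b_gt0 : 0 < b by rewrite lt_def bn0.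
split; first by rewrite lte_fin divr_gt0.
by rewrite -ler_pdivlMr//= ge_min lexx.
Qed.

(* This is [8 (1 + 2 L) / (g t^2)] for [L = 2 k (d+1)^2] one-sided deviation events and
   [t = (clip1 c)^2 g / (64 d)]; the factor [1 + 2 L] absorbs [ln L] since [ln (1/eps) >= 1/2]. *)
Definition shape_parameter (R : realType) (d : nat) (c : \bar R) (k : nat) (g : R) : \bar R :=
  if (0 < c)%E && (0 < g) then
    (8 * (1 + 2 * (2 * (k * d.+1 ^ 2))%:R) * (64 * d)%:R ^+ 2
      / (g ^+ 3 * clip1 c ^+ 4))%:E
  else +oo%E.

Lemma shape_parameter_ge0 (R : realType) (d : nat) (c : \bar R) (k : nat) (g : R) :
  (0 <= shape_parameter d c k g)%E.
Proof.
rewrite /shape_parameter; case: ifP => // /andP[c0 g0].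
rewrite lee_fin; apply: divr_ge0.
  by apply: mulr_ge0; rewrite ?exprn_ge0// mulr_ge0// addr_ge0 ?mulr_ge0.
by rewrite mulr_ge0// exprn_ge0// ltW// clip1_gt0.
Qed.

Lemma le_shape_parameter (R : realType) (d1 d2 : nat) (c1 c2 : \bar R) (k1 k2 : nat) (g1 g2 : R) :
  (d1 <= d2)%N -> (c2 <= c1)%E -> (k1 <= k2)%N -> g2 <= g1 ->
  (shape_parameter d1 c1 k1 g1 <= shape_parameter d2 c2 k2 g2)%E.
Proof.
move=> dd cc kk gg; rewrite /shape_parameter.
case: (boolP ((0 < c2)%E && (0 < g2))) => [/andP[c0 g0]|_]; last by rewrite leey.
rewrite (lt_le_trans c0 cc) (lt_le_trans g0 gg) /= lee_fin.
have k0 := clip1_gt0 c0; have kle := le_clip1 c0 cc.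
have den0 : 0 < g2 ^+ 3 * clip1 c2 ^+ 4 by rewrite mulr_gt0 ?exprn_gt0.
have denle : g2 ^+ 3 * clip1 c2 ^+ 4 <= g1 ^+ 3 * clip1 c1 ^+ 4.
  have h1 : 0 < clip1 c1 by exact: lt_le_trans kle.
  have h2 : 0 < g1 by exact: lt_le_trans gg.
  have := ltW h1; have := ltW h2; have := ltW g0; have := ltW k0 => *.
  by apply: ler_pM; rewrite ?exprn_ge0 ?lerXn2r ?nnegrE.
apply: ler_pM.
- by rewrite !mulr_ge0 ?exprn_ge0// addr_ge0 ?mulr_ge0.
- by rewrite invr_ge0 ltW// (lt_le_trans den0).
- apply: ler_pM; rewrite ?mulr_ge0 ?exprn_ge0 ?addr_ge0 ?mulr_ge0//.
    by rewrite ler_pM2l// lerD2l ler_pM2l// ler_nat leq_mul2l leq_mul// leq_exp2r.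
  by rewrite lerXn2r ?nnegrE// ler_nat leq_mul2l.
- by rewrite lef_pV2 ?posrE// (lt_le_trans den0).
Qed.

(** [L] is at most both [expR L] and [2 * L * ln eps^-1], so the prefactor can be absorbed into the
    exponent. *)
Lemma exponential_tail_le (R : realType) (L y eps : R) : 0 <= L -> 0 < eps < 2^-1 ->
  (1 + 2 * L) * ln eps^-1 <= y -> L * expR (- y) <= eps.
Proof.
move=> L0 /andP[e0 e2] hy.
have l2 : 2^-1 <= ln eps^-1.
  rewrite -ler_expR lnK ?posrE ?invr_gt0//.
  apply: (@le_trans _ _ 2); last by rewrite -[leLHS]invrK lef_pV2 ?posrE// ltW.
  by have := @expR_le_quadratic R 2^-1 (lexx _); lra.
have Ly : L - y <= - ln eps^-1.
  have : L * 2^-1 <= L * ln eps^-1 by rewrite ler_wpM2l.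
  by move: hy; lra.
apply: (@le_trans _ _ (expR (L - y))).
  rewrite expRD ler_wpM2r ?expR_ge0// (le_trans _ (expR_ge1Dx L))//; lra.
apply: (@le_trans _ _ (expR (- ln eps^-1))); first by rewrite ler_expR.
by rewrite expRN lnK ?posrE ?invr_gt0// invrK.
Qed.

Theorem theorem2 (R : realType) :
  exists f : nat -> \bar R -> \bar R -> nat -> R -> R -> \bar R,
    (* C takes values in [0, +oo] *)
    (forall a b c e g h, (0 <= f a b c e g h)%E) /\
    (* (b) monotonicity: nondecreasing in d, k, pi_max; nonincreasing in
       km_Delta/r, km_prox/r, pi_min *)
    (forall d1 d2 b c e g h, (d1 <= d2)%N -> (f d1 b c e g h <= f d2 b c e g h)%E) /\
    (forall a b1 b2 c e g h, (b1 <= b2)%E -> (f a b2 c e g h <= f a b1 c e g h)%E) /\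
    (forall a b c1 c2 e g h, (c1 <= c2)%E -> (f a b c2 e g h <= f a b c1 e g h)%E) /\
    (forall a b c e1 e2 g h, (e1 <= e2)%N -> (f a b c e1 g h <= f a b c e2 g h)%E) /\
    (forall a b c e g1 g2 h, g1 <= g2 -> (f a b c e g2 h <= f a b c e g1 h)%E) /\
    (forall a b c e g h1 h2, h1 <= h2 -> (f a b c e g h1 <= f a b c e g h2)%E) /\
    (* (a) *)
    (forall (d n k : nat), (1 <= d)%N -> (2 <= k)%N -> (k <= n)%N ->
     forall (x : 'I_n -> 'cV[R]_d) (G : {set {set 'I_n}}),
       finset.partition G [set: 'I_n] -> #|G| = k ->
       0 < km_prox x G -> km_rad x G <= km_Delta x G / 2%:R ->
       let C := f d (km_ratio (km_Delta x G) (km_rad x G)) (km_ratio (km_prox x G) (km_rad x G))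
                  k (@km_pimin R n G) (@km_pimax R n G) in
       (C < +oo)%E /\
       forall (eps p : R), 0 < eps < 2%:R^-1 -> 0 < p <= 1 ->
         ((p * n%:R)%:E > C * (ln eps^-1)%:E)%E ->
         1 - eps <= km_bern_prob p (km_exact_recovery k x G)).
Proof.
exists (fun d b c k g h => shape_parameter d c k g).
split; first by move=> *; exact: shape_parameter_ge0.
do 6! (split; first by move=> *; exact: le_shape_parameter).
move=> d n k d1 k2 kn x G hG Gk q0 hr C.
have n0 : (0 < n)%N by exact: leq_trans (ltnW k2) kn.
have r0 : 0 <= km_rad x G.
  have SG := partitionT_pblock_in (Ordinal n0) hG.
  exact: le_trans (enorm_ge0 _) (km_rad_ge _ SG (partitionT_mem_pblock (Ordinal n0) hG)).
have [c0 cr] := clip1_ratio q0 r0.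
have g0 := km_pimin_gt0 R hG n0; have g1 := km_pimin_le1 R hG n0.
have := clip1_gt0 c0; have := clip1_le1 (km_ratio (km_prox x G) (km_rad x G)).
rewrite /C /shape_parameter c0 g0 /= {C}.
move: (clip1 _) cr => a ar a1 a0; split; first by rewrite ltry.
move=> eps p e01 p01; rewrite -EFinM lte_fin => hp.
have d0 : 0 < d%:R :> R by rewrite ltr0n.
set r := km_rad x G in hr r0 ar *; set q := km_prox x G in q0 ar *.
set g := km_pimin R G in g0 g1 hp *.
(* Then [t * d] is [a ^+ 2 * g / 64]. Since [a * r] is at most [q] and [a], [g] are at most 1, one
   power of [a * r] settles the centroid shift and two settle the covariances. *)
pose t := a ^+ 2 * g / (64 * d%:R).
have a0' := ltW a0; have g0' := ltW g0; have q0' := ltW q0.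
have a2 : a ^+ 2 <= 1 by rewrite expr_le1.
have t0 : 0 < t by rewrite divr_gt0 ?mulr_gt0 ?exprn_gt0.
have td : t * d%:R = a ^+ 2 * g / 64 by rewrite /t; field; rewrite lt0r_neq0.
have agle : a ^+ 2 * g <= 1 by rewrite mulr_ile1 ?exprn_ge0.
have t64 : t <= 1 / 64.
  apply: (@le_trans _ _ (t * d%:R)); first by rewrite ler_peMr ?(ltW t0) ?ler1n.
  by rewrite td; move: agle; lra.
have ht1 : t * r * d%:R * 2 <= q / 32.
  have -> : t * r * d%:R * 2 = a * g * (a * r) / 32.
    by transitivity (t * d%:R * r * 2); [ring | rewrite td; field].
  rewrite ler_pM2r ?invr_gt0// (le_trans _ ar)// ler_piMl ?mulr_ge0//.
  by rewrite mulr_ile1.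
have ht2 : t * d%:R * r ^+ 2 <= q ^+ 2 * g / 64.
  rewrite td; have : (a * r) ^+ 2 <= q ^+ 2 by rewrite lerXn2r ?nnegrE ?mulr_ge0.
  by rewrite -(ler_pM2r g0); lra.
have t01 : 0 <= t <= 1 / 64 by rewrite (ltW t0).
have := recovery_probability_ge hG d1 n0 q0 hr p01 t01 ht1 ht2.
rewrite Gk; apply: le_trans; rewrite lerD2l lerN2.
apply: exponential_tail_le => //; rewrite ler_pdivlMr//.
(* Multiplying the sample size assumption by [g * t ^+ 2] turns it into the required lower bound on
   the Chernoff exponent. *)
have gt0 : 0 < g * t ^+ 2 by rewrite mulr_gt0 ?exprn_gt0.
move: hp; rewrite -(ltr_pM2r gt0) => /ltW.
rewrite [X in _ <= X -> _](_ : _ = p * (g * n%:R) * t ^+ 2); last by ring.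
apply: le_trans; rewrite le_eqVlt; apply/orP; left; apply/eqP.
rewrite [in RHS]/t natrM; field.
by rewrite !lt0r_neq0.
Qed.
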